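(* Let $H$ be a $\mathrm{PSL}_2(\mathbb Z)$-cyclically reduced finitely generated subgroup of $\mathrm{PSL}_2(\mathbb Z)$, with Stallings graph $\Gamma$ and isomorphism type $(\ell_2,\ell_3,r)$. If $\mathrm{silh}(\Gamma)$ has isomorphism type $(\ell_2',\ell_3',r')$, then $r=r'$. In particular, $\mathrm{silh}(\Gamma)=\Delta_1$ if and only if $r=0$, and $\mathrm{silh}(\Gamma)=\Delta_2$ if and only if $r=1$.
   Context: $\mathrm{PSL}_2(\mathbb Z)=\langle a,b\mid a^2=b^3=1\rangle$. Each element has a unique geodesic representative (words over $\{a,b,b^{-1}\}$ of length at most 1, or alternating $a$ and letters in $\{b,b^{-1}\}$). The Schreier graph of a subgroup $H$ has vertices the cosets $Hg$, undirected $a$-edges between $Hg$ and $Hga$ and directed $b$-edges from $Hg$ to $Hgb$; the Stallings graph $(\Gamma(H),v_0)$ is its subgraph spanned by the loops at $v_0=H$ labeled by geodesic representatives of elements of $H$, rooted at $v_0$. By Kurosh's theorem a finitely generated $H$ is a free product of $r_2$ copies of $\mathbb Z_2$, $r_3$ copies of $\mathbb Z_3$ and a free group of rank $r$; the triple $(r_2,r_3,r)$ is the isomorphism type of $H$. A $\mathrm{PSL}_2(\mathbb Z)$-cyclically reduced graph is a finite connected graph with undirected $a$-edges and directed $b$-edges such that: every vertex lies on exactly one $a$-edge, which is either an $a$-loop or an isolated $a$-edge (joining two distinct vertices); the $b$-edges form a partial injective map on vertices, every vertex lies on a $b$-edge, and each $b$-edge is a $b$-loop, or an isolated $b$-edge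 (joining two distinct vertices lying on no other $b$-edge), or one of the edges of a $b$-triangle (a directed 3-cycle on three distinct vertices). $H$ is $\mathrm{PSL}_2(\mathbb Z)$-cyclically reduced if its Stallings graph is. Every cyclically reduced graph, rooted at any vertex, is the Stallings graph of a unique finitely generated subgroup; different roots give conjugate subgroups, and the isomorphism type of the graph is that of these subgroups. Special graphs: $\Delta_1$ has one vertex carrying an $a$-loop and a $b$-loop; $\Delta_2$ has two vertices joined by an isolated $a$-edge and by an isolated $b$-edge; $\Delta_3$ has two vertices joined by an isolated $b$-edge, each carrying an $a$-loop. Moves on a cyclically reduced graph (deleting a vertex also deletes its adjacent edges): - $\lambda_3$: if $v$ carries a $b$-loop and an isolated $a$-edge joins $v$ to $w\ne v$, delete $v$ and add an $a$-loop at $w$. - $\lambda_{2,1}$: if $v$ carries an $a$-loop and lies on a $b$-triangle $w\to v\to w'\to w$, delete $v$ (the $b$-edge $w'\to w$ becomes isolated). - $\lambda_{2,2}$: if $v$ carries an $a$-loop, an isolated $b$-edge (of either orientation) joins $v$ and $w\ne v$, and an isolated $a$-edge joins $w$ to $w'\notin\{v,w\}$, delete $v$ and $w$ and add an $a$-loop at $w'$. - $\kappa_3$: if there is an isolated $b$-edge $v\to w$, and isolated $a$-edges join $v$ to $v'$ and $w$ to $w'$ with $v,w,v',w'$ pairwise distinct, delete $v$ and $w$ and add an isolated $a$-edge between $v'$ and $w'$. - $\mathrm{exc}$: if the graph is $\Delta_3$, replace it by $\Delta_1$. The silhouette $\mathrm{silh}(\Gamma)$ is the graph (considered up to isomorphism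 here) obtained by applying a maximal sequence of moves to $\Gamma$; it does not depend on the sequence chosen. *)

(* Defs.v *)
From HB Require Import structures.
From Stdlib Require Import Relation_Operators.
From mathcomp Require Import all_boot.
From mathcomp Require Import all_classical.

Set Implicit Arguments.
Unset Strict Implicit.
Unset Printing Implicit Defensive.

Local Open Scope classical_set_scope.
Local Open Scope group_scope.
Local Open Scope quotient_scope.

(* Groups given by generators and relators.  In a word over X, the letter
   (x, true) stands for x and (x, false) for x^-1. *)

Definition pword (X : choiceType) := seq (X * bool).

Definition pinv (X : choiceType) (w : pword X) : pword X :=
  rev [seq (l.1, ~~ l.2) | l <- w].

Inductive pres_eq (X : choiceType) (R : set (pword X)) :
    pword X -> pword X -> Prop :=
| pres_refl w : pres_eq R w w
| pres_sym u v : pres_eq R u v -> pres_eq R v u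
| pres_trans u v w : pres_eq R u v -> pres_eq R v w -> pres_eq R u w
| pres_cancel u v x e :
    pres_eq R (u ++ [:: (x, e); (x, ~~ e)] ++ v) (u ++ v)
| pres_relator u v s : R s -> pres_eq R (u ++ s ++ v) (u ++ v).

Definition pres_eqb (X : choiceType) (R : set (pword X)) : rel (pword X) :=
  fun u v => `[< pres_eq R u v >].

Lemma pres_eqb_refl X R : reflexive (@pres_eqb X R).
Proof. by move=> w; apply/asboolP/pres_refl. Qed.

Lemma pres_eqb_sym X R : symmetric (@pres_eqb X R).
Proof. by move=> u v; apply/asboolP/asboolP => /pres_sym. Qed.

Lemma pres_eqb_trans X R : transitive (@pres_eqb X R).
Proof.
by move=> v u w /asboolP uv /asboolP vw; apply/asboolP/(pres_trans uv vw).
Qed.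

Canonical pres_equiv X R :=
  EquivRel (@pres_eqb X R) (@pres_eqb_refl X R) (@pres_eqb_sym X R)
    (@pres_eqb_trans X R).

Definition presented (X : choiceType) (R : set (pword X)) :=
  {eq_quot pres_equiv R}.

HB.instance Definition _ X R := Choice.on (@presented X R).

Definition pclass (X : choiceType) (R : set (pword X)) (w : pword X) :
  presented R := \pi_(presented R) w.

Lemma pclassP X (R : set (pword X)) u v :
  pclass R u = pclass R v <-> pres_eq R u v.
Proof.
split => [/eqP|uv]; rewrite /pclass; first by rewrite piE => /asboolP.
by apply/eqP; rewrite piE; apply/asboolP.
Qed.

Lemma pres_catl X (R : set (pword X)) w u v :
  pres_eq R u v -> pres_eq R (w ++ u) (w ++ v).
Proof.
elim=> {u v} [u|u v _|u v t _ h _|u v x e|u v s Rs].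
- exact: pres_refl.
- exact: pres_sym.
- exact: pres_trans h.
- by rewrite !catA -(catA (w ++ u)); apply: pres_cancel.
- by rewrite !catA -(catA (w ++ u)); apply: pres_relator.
Qed.

Lemma pres_catr X (R : set (pword X)) w u v :
  pres_eq R u v -> pres_eq R (u ++ w) (v ++ w).
Proof.
elim=> {u v} [u|u v _|u v t _ h _|u v x e|u v s Rs].
- exact: pres_refl.
- exact: pres_sym.
- exact: pres_trans h.
- by rewrite -!catA; apply: pres_cancel.
- by rewrite -!catA; apply: pres_relator.
Qed.

Lemma pinvK X : involutive (@pinv X).
Proof.
move=> w; rewrite /pinv map_rev revK -map_comp map_id_in // => -[x e] _ /=.
by rewrite negbK.
Qed.

Lemma pres_mulV X (R : set (pword X)) w : pres_eq R (w ++ pinv w) [::].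
Proof.
elim: w => [|[x e] w IH]; first exact: pres_refl.
rewrite /pinv map_cons rev_cons -cats1 -/(pinv w) -cat1s -catA (catA w).
apply: pres_trans (pres_cancel R [::] [::] x e).
by apply: (@pres_catl _ _ [:: (x, e)]); apply: (@pres_catr _ _ _ _ [::]).
Qed.

Lemma pres_mulVl X (R : set (pword X)) w : pres_eq R (pinv w ++ w) [::].
Proof. by rewrite -{2}(pinvK w); apply: pres_mulV. Qed.

Lemma pinv_cat X (u v : pword X) : pinv (u ++ v) = pinv v ++ pinv u.
Proof. by rewrite /pinv map_cat rev_cat. Qed.

Lemma pres_inv X (R : set (pword X)) u v :
  pres_eq R u v -> pres_eq R (pinv u) (pinv v).
Proof.
move=> uv; apply: (@pres_trans _ _ _ (pinv u ++ (v ++ pinv v))).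
  rewrite -{1}(cats0 (pinv u)); apply/pres_catl/pres_sym/pres_mulV.
apply: (@pres_trans _ _ _ (pinv u ++ (u ++ pinv v))).
  by apply/pres_catl/pres_catr/pres_sym.
by rewrite catA; apply: (@pres_catr _ _ _ _ [::]); apply: pres_mulVl.
Qed.

Definition pone X (R : set (pword X)) : presented R := pclass R [::].
Definition pmul X (R : set (pword X)) (x y : presented R) : presented R :=
  pclass R (repr x ++ repr y).
Definition ppinv X (R : set (pword X)) (x : presented R) : presented R :=
  pclass R (pinv (repr x)).

Lemma pres_repr X (R : set (pword X)) w : pres_eq R (repr (pclass R w)) w.
Proof. by apply/pclassP; rewrite /pclass reprK. Qed.

Lemma pmulE X (R : set (pword X)) u v :
  pmul (pclass R u) (pclass R v) = pclass R (u ++ v).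
Proof.
apply/pclassP; apply: (@pres_trans _ _ _ (u ++ repr (pclass R v))).
  exact/pres_catr/pres_repr.
exact/pres_catl/pres_repr.
Qed.

Lemma ppinvE X (R : set (pword X)) u :
  ppinv (pclass R u) = pclass R (pinv u).
Proof. exact/pclassP/pres_inv/pres_repr. Qed.

Lemma pclass_repr X (R : set (pword X)) (x : presented R) :
  pclass R (repr x) = x.
Proof. exact: reprK. Qed.

Lemma pmulA X (R : set (pword X)) : associative (@pmul X R).
Proof.
move=> x y z; rewrite -(pclass_repr x) -(pclass_repr y) -(pclass_repr z).
by rewrite !pmulE catA.
Qed.

Lemma pmul1 X (R : set (pword X)) : left_id (pone R) (@pmul X R).
Proof. by move=> x; rewrite -(pclass_repr x) pmulE. Qed.

Lemma pmulr1 X (R : set (pword X)) : right_id (pone R) (@pmul X R).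
Proof. by move=> x; rewrite -(pclass_repr x) pmulE cats0. Qed.

Lemma pmulVg X (R : set (pword X)) :
  left_inverse (pone R) (@ppinv X R) (@pmul X R).
Proof.
move=> x; rewrite -(pclass_repr x) ppinvE pmulE.
exact/pclassP/pres_mulVl.
Qed.

Lemma pmulgV X (R : set (pword X)) :
  right_inverse (pone R) (@ppinv X R) (@pmul X R).
Proof.
move=> x; rewrite -(pclass_repr x) ppinvE pmulE.
exact/pclassP/pres_mulV.
Qed.

HB.instance Definition _ X (R : set (pword X)) :=
  isGroup.Build (presented R) (@pmulA X R) (@pmul1 X R) (@pmulr1 X R)
    (@pmulVg X R) (@pmulgV X R).

Definition pgen (X : choiceType) (R : set (pword X)) (x : X) : presented R :=
  pclass R [:: (x, true)].

(* PSL_2(Z) = < a, b | a^2 = b^3 = 1 >, with a = false and b = true. *)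

Definition psl_relators : set (pword bool) :=
  [set nseq 2 (false, true); nseq 3 (true, true)].

Definition PSL2Z : groupType := presented psl_relators.
Definition psl_a : PSL2Z := pgen psl_relators false.
Definition psl_b : PSL2Z := pgen psl_relators true.

Definition is_subgroup (H : set PSL2Z) : Prop :=
  H 1 /\ forall x y, H x -> H y -> H (x * y^-1).

Definition finitely_generated (H : set PSL2Z) : Prop :=
  exists s : seq PSL2Z, H = smallest is_subgroup [set` s].

(* The free product of r2 copies of Z/2, r3 copies of Z/3 and a free group of
   rank r, through its standard presentation
   < x_i (i < r2), y_j (j < r3), z_k (k < r) | x_i^2, y_j^3 >. *)

Definition fprod_relators (r2 r3 r : nat) :
    set (pword ('I_r2 + 'I_r3 + 'I_r)%type) :=
  [set nseq 2 (inl (inl i), true) | i in [set: 'I_r2]] `|`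
  [set nseq 3 (inl (inr j), true) | j in [set: 'I_r3]].

Arguments fprod_relators : clear implicits.

Definition free_product (r2 r3 r : nat) : groupType :=
  presented (fprod_relators r2 r3 r).

Definition iso_type (H : set PSL2Z) (r2 r3 r : nat) : Prop :=
  exists f : {multiplicative free_product r2 r3 r -> PSL2Z},
    injective f /\ range f = H.

Inductive letter := La | Lb | LB. (* a, b, b^-1 *)

Definition is_a (l : letter) : bool := if l is La then true else false.

Definition letter_val (l : letter) : PSL2Z :=
  match l with La => psl_a | Lb => psl_b | LB => psl_b^-1 end.

Fixpoint word_val (w : seq letter) : PSL2Z :=
  if w is l :: w' then letter_val l * word_val w' else 1.

(* Words of length at most 1 are sorted for any relation. *)
Definition geodesic (w : seq letter) : bool :=
  sorted (fun l l' => is_a l != is_a l') w.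

(* Graphs with a-edges and b-edges whose vertices form a subset of an ambient
   type U.  There is at most one a-edge between two vertices, and at most one
   b-edge from a vertex to another. *)
Record graph (U : Type) := Graph {
  vset : set U;
  aE : U -> U -> Prop;
  bE : U -> U -> Prop
}.

Section GraphDefs.
Context {U : Type}.
Implicit Type G : graph U.

Definition wf_graph G : Prop :=
  [/\ forall x y, aE G x y -> vset G x /\ vset G y,
      forall x y, aE G x y -> aE G y x
    & forall x y, bE G x y -> vset G x /\ vset G y].

Definition connected_graph G : Prop :=
  vset G !=set0 /\
  forall x y, vset G x -> vset G y ->
    clos_refl_sym_trans U (fun u v => aE G u v \/ bE G u v) x y.

Definition isolated_a G v w : Prop :=
  [/\ v <> w, aE G v w, forall x, aE G v x -> x = w
    & forall x, aE G w x -> x = v].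

Definition isolated_b G v w : Prop :=
  [/\ v <> w, bE G v w
    & forall x y, bE G x y ->
        [\/ x = v, x = w, y = v | y = w] -> x = v /\ y = w].

Definition b_triangle G x y z : Prop :=
  [/\ x <> y, y <> z & z <> x] /\ [/\ bE G x y, bE G y z & bE G z x].

Definition cyclically_reduced G : Prop :=
  [/\ wf_graph G, finite_set (vset G) & connected_graph G] /\
  [/\ (* exactly one a-edge at v, with other end w: a loop if w = v, and
         otherwise an isolated a-edge *)
      forall v, vset G v ->
        exists w, aE G v w /\ (forall x, aE G v x -> x = w) /\
                  (w = v \/ isolated_a G v w),
      forall x y y', bE G x y -> bE G x y' -> y = y',
      forall x x' y, bE G x y -> bE G x' y -> x = x',
      forall v, vset G v -> exists w, bE G v w \/ bE G w v
    & forall v w, bE G v w ->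
        [\/ v = w, isolated_b G v w | exists x, b_triangle G v w x]].

Definition delete (D : set U) G : graph U :=
  {| vset := vset G `\` D;
     aE := fun x y => [/\ aE G x y, ~ D x & ~ D y];
     bE := fun x y => [/\ bE G x y, ~ D x & ~ D y] |}.

(* An a-loop at v when v = w. *)
Definition add_a v w G : graph U :=
  {| vset := vset G;
     aE := fun x y => [\/ aE G x y, x = v /\ y = w | x = w /\ y = v];
     bE := bE G |}.

Definition Delta1_at (v : U) : graph U :=
  {| vset := [set v];
     aE := fun x y => x = v /\ y = v;
     bE := fun x y => x = v /\ y = v |}.

End GraphDefs.

Definition iso_by (U U' : Type) (f : U -> U') (G : graph U) (G' : graph U') :=
  set_bij (vset G) (vset G') f /\
  forall x y, vset G x -> vset G y ->
    (aE G x y <-> aE G' (f x) (f y)) /\ (bE G x y <-> bE G' (f x) (f y)).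

Definition graph_iso U U' (G : graph U) (G' : graph U') : Prop :=
  exists f : U -> U', iso_by f G G'.

Definition rooted_iso U U' (G : graph U) (v : U) (G' : graph U') (v' : U') :=
  exists f : U -> U', iso_by f G G' /\ f v = v'.

Definition Delta1 : graph unit := Delta1_at tt.

Definition Delta2 : graph bool :=
  {| vset := [set: bool];
     aE := fun x y => x <> y;
     bE := fun x y => x = false /\ y = true |}.

Definition Delta3 : graph bool :=
  {| vset := [set: bool];
     aE := fun x y => x = y;
     bE := fun x y => x = false /\ y = true |}.

Inductive move (U : Type) (G : graph U) : graph U -> Prop :=
| lambda3 v w : bE G v v -> isolated_a G v w ->
    move G (add_a w w (delete [set v] G))
| lambda21 v w w' : aE G v v -> b_triangle G w v w' ->
    move G (delete [set v] G)
| lambda22 v w w' : aE G v v -> isolated_b G v w \/ isolated_b G w v ->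
    isolated_a G w w' -> w' <> v -> w' <> w ->
    move G (add_a w' w' (delete [set v; w] G))
| kappa3 v w v' w' : isolated_b G v w -> isolated_a G v v' ->
    isolated_a G w w' ->
    [/\ v <> w, v <> v' & v <> w'] -> [/\ w <> v', w <> w' & v' <> w'] ->
    move G (add_a v' w' (delete [set v; w] G))
| exc v : graph_iso G Delta3 -> vset G v -> move G (Delta1_at v).

(* S is the result of a maximal sequence of moves from G. *)
Definition silhouette U (G S : graph U) : Prop :=
  clos_refl_trans _ (@move U) G S /\ ~ exists S', move S S'.

(* Right cosets of H are represented as subsets of PSL_2(Z). *)
Definition rcoset_set (H : set PSL2Z) (g : PSL2Z) : set PSL2Z :=
  [set h * g | h in H].

Definition schreier (H : set PSL2Z) : graph (set PSL2Z) :=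
  {| vset := range (rcoset_set H);
     aE := fun K L => exists g,
       (K = rcoset_set H g /\ L = rcoset_set H (g * psl_a)) \/
       (L = rcoset_set H g /\ K = rcoset_set H (g * psl_a));
     bE := fun K L => exists g,
       K = rcoset_set H g /\ L = rcoset_set H (g * psl_b) |}.

Definition edge U (G : graph U) (l : letter) (x y : U) : Prop :=
  match l with La => aE G x y | Lb => bE G x y | LB => bE G y x end.

Fixpoint walk U (G : graph U) (x : U) (w : seq letter) (y : U) : Prop :=
  if w is l :: w' then exists z, edge G l x z /\ walk G z w' y else x = y.

(* w labels a loop at the vertex H of the Schreier graph and is the geodesic
   representative of an element of H *)
Definition geodesic_loop (H : set PSL2Z) (w : seq letter) : Prop :=
  [/\ geodesic w, H (word_val w) & walk (schreier H) H w H].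

Definition on_loop (H : set PSL2Z) (x : set PSL2Z) : Prop :=
  exists p q, [/\ geodesic_loop H (p ++ q),
    walk (schreier H) H p x & walk (schreier H) x q H].

Definition crossed (H : set PSL2Z) (l : letter) (x y : set PSL2Z) : Prop :=
  exists p q, [/\ geodesic_loop H (p ++ l :: q), walk (schreier H) H p x,
    edge (schreier H) l x y & walk (schreier H) y q H].

(* Edges may be crossed in both directions. *)
Definition stallings (H : set PSL2Z) : graph (set PSL2Z) :=
  {| vset := on_loop H;
     aE := fun x y => crossed H La x y \/ crossed H La y x;
     bE := fun x y => crossed H Lb x y \/ crossed H LB y x |}.

Definition psl_cyclically_reduced (H : set PSL2Z) : Prop :=
  cyclically_reduced (stallings H).

(* The isomorphism type of a graph is that of a subgroup whose rooted
   Stallings graph it is, for some choice of the root. *)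
Definition graph_iso_type U (G : graph U) (r2 r3 r : nat) : Prop :=
  exists v (K : set PSL2Z),
    [/\ vset G v, is_subgroup K, finitely_generated K,
        rooted_iso G v (stallings K) K & iso_type K r2 r3 r].

(* Main.v *)
(* Counting each vertex of a reduced graph with weight 1/|a-component| +
   1/|b-component| - 1 gives chi = #a-components + #b-components - #vertices,
   and each move deletes vertices in such a way that chi is unchanged.  When K
   is a subgroup of type (r2, r3, r) whose Stallings graph has vertex set V,
   the space Hom(K, Q) has dimension r.  A function u on V defines the
   homomorphism which adds up the increments of u along the a-edges of a loop.
   Averaging over <a> and <b> shows that all homomorphisms arise in this way,
   and the kernel of this map is the sum of the space of functions constant on
   a-components and of that of functions constant on b-components, which meet
   in the constants since the graph is connected.  Hence r = 1 - chi.  Finally a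
   graph without moves is Delta1 (chi = 1), Delta2 (chi = 0), or has neither
   loops nor isolated b-edges, so that all weights are 1/2 + 1/3 - 1 < 0. *)

Require Import Defs.
From mathcomp Require Import all_boot all_order all_algebra.
From mathcomp Require Import all_classical.
From mathcomp Require Import ring lra.

Set Implicit Arguments.
Unset Strict Implicit.
Unset Printing Implicit Defensive.

Import Order.TTheory GRing.Theory Num.Theory.

Local Open Scope classical_set_scope.
Local Open Scope ring_scope.

(** * Reduced graphs and their components *)

(* Cyclic reducedness with the b-components described by red_bT: a b-path of
   length two is closed up by a b-edge, so its edges are equal b-loops or lie
   on a b-triangle. *)
Record reduced (U : Type) (G : graph U) : Prop := Reduced {
  red_wf : wf_graph G;
  red_fin : finite_set (vset G);
  red_neq0 : vset G !=set0;
  red_conn : forall P : U -> Prop,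
    (forall x y, aE G x y \/ bE G x y -> (P x <-> P y)) ->
    forall x y, vset G x -> vset G y -> P x -> P y;
  red_a : forall v, vset G v -> exists w, aE G v w;
  red_aF : forall v w w', aE G v w -> aE G v w' -> w = w';
  red_b : forall v, vset G v -> exists w, bE G v w \/ bE G w v;
  red_bF : forall v w w', bE G v w -> bE G v w' -> w = w';
  red_bI : forall v v' w, bE G v w -> bE G v' w -> v = v';
  red_bT : forall v w x, bE G v w -> bE G w x -> bE G x v }.

Lemma cyclically_reduced_reduced U (G : graph U) :
  cyclically_reduced G -> reduced G.
Proof.
case=> -[wf fin [ne conn]] [ha bF bI hb bC]; split => //.
(* Path connectivity becomes an induction principle: a predicate whose truth value is preserved
   along every edge has the same truth value at all vertices. *)
- move=> P PE x y Vx Vy; suff -> : P x <-> P y by [].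
  elim: (conn x y Vx Vy) => {x y Vx Vy} [a b /PE //|//|a b _ -> //|].
  by move=> a b c _ -> _ ->.
- by move=> v /ha[w [vw _]]; exists w.
- case: (wf) => aV _ _ v w w' vw vw'; have [Vv _] := aV _ _ vw.
  by have [x [_ [xE _]]] := ha v Vv; rewrite (xE _ vw) (xE _ vw').
- move=> v w x vw wx; case: (bC _ _ vw) => [vE|[vDw _ iso]|[y [[_ _ _]]]].
  + by subst w; rewrite -(bF _ _ _ vw wx).
  + by have [/esym] : w = v /\ x = w by apply: iso => //; constructor.
  + by case=> _ wy yv; rewrite (bF _ _ _ wx wy).
Qed.

Section Reduced.
Variables (U : choiceType) (G : graph U).
Hypothesis red : reduced G.

Lemma red_isolated_a v w : v <> w -> aE G v w -> isolated_a G v w.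
Proof.
move=> vDw vw; have wv : aE G w v by have [_ s _] := red_wf red; apply: s.
split=> // x xE; first exact: (red_aF red xE vw).
exact: (red_aF red xE wv).
Qed.

(** An edge entering [v] would be closed up by [red_bT] to an edge leaving [w], so the absence of
    edges out of [w] isolates the whole component. *)
Lemma red_isolated_b v w :
  bE G v w -> ~ (exists x, bE G w x) -> isolated_b G v w.
Proof.
move=> vw nw; split=> //.
  by move=> vE; apply: nw; exists w; rewrite -{1}vE.
move=> x y xy [xE|xE|yE|yE]; subst.
- by rewrite (red_bF red xy vw).
- by case: nw; exists y.
- by case: nw; exists x; apply: (red_bT red xy vw).
- by rewrite (red_bI red xy vw).
Qed.

Lemma red_b_triangle v w x :
  bE G v w -> bE G w x -> v <> w -> b_triangle G v w x.
Proof.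
move=> vw wx vDw; have xv := red_bT red vw wx; split; split=> //.
- by move=> wE; subst x; apply: vDw; rewrite (red_bI red vw wx).
- by move=> xE; subst x; apply: vDw; rewrite (red_bF red xv vw).
Qed.

End Reduced.

(** * Weights and the characteristic [chi] *)

Definition a_weight (U : Type) (G : graph U) v : rat :=
  if `[< aE G v v >] then 1 else 2^-1.

(** In a reduced graph, a vertex without a b-loop but with b-edges in both directions lies on a
    b-triangle, and one with a single direction is an end of an isolated b-edge. The value is thus
    the inverse of the size of the b-component. *)
Definition b_weight (U : Type) (G : graph U) v : rat :=
  if `[< bE G v v >] then 1 else
  if `[< (exists w, bE G v w) /\ (exists w, bE G w v) >] then 3^-1 else 2^-1.

Definition weight (U : Type) (G : graph U) v : rat :=
  a_weight G v + b_weight G v - 1.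

(* For a reduced graph, the weights of the vertices of an a-component, and
   those of a b-component, add up to 1: this is the number of a-components
   plus the number of b-components minus the number of vertices. *)
Definition chi (U : choiceType) (G : graph U) : rat :=
  \sum_(v \in vset G) weight G v.

Section Weight.
Context {U : Type}.
Implicit Type G : graph U.

Lemma a_weight_loop G v : aE G v v -> a_weight G v = 1.
Proof. by rewrite /a_weight; case: asboolP. Qed.

Lemma a_weight_edge G v : ~ aE G v v -> a_weight G v = 2^-1.
Proof. by rewrite /a_weight; case: asboolP. Qed.

Lemma b_weight_loop G v : bE G v v -> b_weight G v = 1.
Proof. by rewrite /b_weight; case: asboolP. Qed.

Lemma b_weight_triangle G v u w :
  ~ bE G v v -> bE G u v -> bE G v w -> b_weight G v = 3^-1.
Proof.
rewrite /b_weight; case: asboolP => // _ _ uv vw; case: asboolP => // -[].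
by split; [exists w|exists u].
Qed.

Lemma b_weight_edge G v : ~ bE G v v ->
  ~ ((exists w, bE G v w) /\ (exists w, bE G w v)) -> b_weight G v = 2^-1.
Proof. by rewrite /b_weight; case: asboolP => //; case: asboolP. Qed.

Lemma isolated_b_weight G v w : isolated_b G v w ->
  b_weight G v = 2^-1 /\ b_weight G w = 2^-1.
Proof.
case=> vDw vw iso; split; apply: b_weight_edge.
- by move=> /iso[|_ //]; first by constructor 1.
- case=> _ [x /iso]; case; first by constructor 3.
  by move=> _.
- by move=> /iso[|/esym //]; first by constructor 2.
- by case=> -[x /iso]; case => [|/esym]; first by constructor 2.
Qed.

End Weight.

Lemma a_weight_ext U U' (G : graph U) (G' : graph U') v v' :
  (aE G v v <-> aE G' v' v') -> a_weight G v = a_weight G' v'.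
Proof. by move=> h; rewrite /a_weight (asbool_equiv_eq h). Qed.

Lemma b_weight_ext U U' (G : graph U) (G' : graph U') v v' :
  (bE G v v <-> bE G' v' v') ->
  ((exists w, bE G v w) <-> (exists w, bE G' v' w)) ->
  ((exists w, bE G w v) <-> (exists w, bE G' w v')) ->
  b_weight G v = b_weight G' v'.
Proof.
move=> /asbool_equiv_eq h ho hi; rewrite /b_weight h.
have /asbool_equiv_eq -> // : ((exists w, bE G v w) /\ (exists w, bE G w v)) <->
  ((exists w, bE G' v' w) /\ (exists w, bE G' w v')).
by split=> -[/ho o /hi i].
Qed.

(** An isomorphism compares edges between vertices only, whereas the weights quantify over the
    ambient type; well-formedness bridges the gap. *)
Lemma chi_iso (U U' : choiceType) (G : graph U) (G' : graph U') :
  wf_graph G -> wf_graph G' -> graph_iso G G' -> chi G = chi G'.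
Proof.
move=> [aV _ bV] [aV' _ bV'] [f [fbij fE]].
have [fV fI fS] := fbij.
have fb x y : vset G x -> vset G y -> bE G x y <-> bE G' (f x) (f y).
  by move=> Vx Vy; have [] := fE x y Vx Vy.
rewrite /chi (reindex_fsbig _ _ _ _ fbij); apply: eq_fsbigr => v.
rewrite inE => Vv; rewrite /weight; congr (_ + _ - 1).
  by apply: a_weight_ext; have [] := fE v v Vv Vv.
apply: b_weight_ext; first exact: fb.
- split=> -[w vw]; first by exists (f w); have [_ Vw] := bV _ _ vw; apply/fb.
  have [_ /fS[x Vx xE]] := bV' _ _ vw.
  by exists x; apply/fb => //; rewrite xE.
- split=> -[w vw]; first by exists (f w); have [Vw _] := bV _ _ vw; apply/fb.
  have [/fS[x Vx xE] _] := bV' _ _ vw.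
  by exists x; apply/fb => //; rewrite xE.
Qed.

Lemma wf_Delta1_at (U : Type) (v : U) : wf_graph (Delta1_at v).
Proof. by split=> x y /= [-> ->]. Qed.

Lemma wf_Delta2 : wf_graph Delta2.
Proof. by split=> x y //= /eqP; rewrite eq_sym => /eqP. Qed.

Lemma wf_Delta3 : wf_graph Delta3.
Proof. by split=> x y //= ->. Qed.

Lemma chi_Delta1_at (U : choiceType) (v : U) : chi (Delta1_at v) = 1.
Proof.
by rewrite /chi /= fsbig_set1 /weight a_weight_loop // b_weight_loop.
Qed.

Lemma fsbig_bool (F : bool -> rat) :
  \sum_(b \in [set: bool]) F b = F true + F false.
Proof.
rewrite (_ : [set: bool] = [set` [:: true; false]]).
  rewrite -fsbig_seq // !big_cons big_nil. by rewrite /= addr0.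
by apply/seteqP; split=> -[] _ //=; rewrite !inE.
Qed.

Lemma chi_Delta2 : chi Delta2 = 0.
Proof.
rewrite /chi fsbig_bool /weight !a_weight_edge //=.
have [|-> ->] := @isolated_b_weight _ Delta2 false true; last by lra.
by split=> //= x y [-> ->].
Qed.

Lemma chi_Delta3 : chi Delta3 = 1.
Proof.
rewrite /chi fsbig_bool /weight !a_weight_loop //=.
have [|-> ->] := @isolated_b_weight _ Delta3 false true; last by lra.
by split=> //= x y [-> ->].
Qed.

(** * Invariance of [chi] under the moves *)

(** The common shape of [lambda3], [lambda22] and [kappa3]: a union [D] of b-components is removed
    and its outer a-neighbours [x] and [y] are joined, by a loop when they coincide. *)
Definition contraction (U : Type) (D : set U) x y (G : graph U) : graph U :=
  add_a x y (delete D G).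

Section Contraction.
Variables (U : choiceType) (G : graph U) (D : set U) (x y : U).
Hypotheses (red : reduced G) (Vx : vset G x) (Vy : vset G y).
Hypotheses (nDx : ~ D x) (nDy : ~ D y).
Hypothesis bD : forall u u', bE G u u' -> (D u <-> D u').
Hypothesis aD :
  forall u u', aE G u u' -> ~ D u -> (D u' <-> u = x \/ u = y).

Let aD' u u' : aE G u u' -> ~ D u -> ~ D u' -> u <> x /\ u <> y.
Proof.
by move=> uu' Du Du'; split=> uE; apply/Du'/(aD uu' Du); [left|right].
Qed.

Lemma reduced_contraction : reduced (contraction D x y G).
Proof.
have [aV aS bV] := red_wf red.
have bD1 u u' : bE G u u' -> ~ D u -> ~ D u' by move=> /bD ->.
have bD2 u u' : bE G u u' -> ~ D u' -> ~ D u by move=> /bD ->.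
split=> /=.
- split=> /= u u'.
  + by case=> [[/aV[]]|[-> ->]|[-> ->]].
  + case=> [[/aS uu' Du Du']|[-> ->]|[-> ->]].
    * by constructor 1.
    * by constructor 3.
    * by constructor 2.
  + by case=> /bV[].
- exact/finite_setD/(red_fin red).
- by exists x.
- move=> P PE u u' [Vu nDu] [Vu' nDu'] Pu.
  have Pxy : P x <-> P y by apply: PE; left; constructor 2.
  (* For connectivity, [P] is extended to the deleted vertices by its value at [x], which agrees
     with its value at [y] because of the added edge. *)
  pose Q z := (~ D z /\ P z) \/ (D z /\ P x).
  have QE z : ~ D z -> Q z <-> P z.
    by move=> nDz; split=> [[[]//|[]//]|Pz]; left.
  have QD z : D z -> Q z <-> P x by move=> Dz; split=> [[[]//|[]//]|Pz]; right.
  suff : Q u' by move/QE; apply.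
  apply: (red_conn red (P := Q) _ Vu Vu'); last exact/QE.
  move=> a b ab; have [Da|nDa] := pselect (D a); have [Db|nDb] := pselect (D b).
  + by rewrite !QD.
  + rewrite QD // QE //; case: ab => [/aS ba|/bD[/(_ Da)//]].
    by have [/(_ Da)[]-> _] := aD ba nDb.
  + rewrite QE // QD //; case: ab => [ab|/bD[_ /(_ Db)//]].
    by have [/(_ Db)[]-> _] := aD ab nDa; last by apply: iff_sym.
  + rewrite !QE //; apply: PE; case: ab => ab; last by right; split.
    by left; constructor 1.
- move=> u [Vu nDu]; have [w uw] := red_a red Vu.
  have [Dw|nDw] := pselect (D w); last by exists w; constructor 1.
  have [/(_ Dw)[]uE _] := aD uw nDu; subst.
    by exists y; constructor 2.
  by exists x; constructor 3.
- move=> u w w' [[uw Du Dw]|[uE wE]|[uE wE]] [[uw' _ Dw']|[uE' wE']|[uE' wE']];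
    subst; rewrite ?uE' //.
  + exact: (red_aF red uw).
  + by case: (aD' uw).
  + by case: (aD' uw).
  + by case: (aD' uw').
  + by case: (aD' uw').
- move=> u [Vu nDu]; have [w [uw|wu]] := red_b red Vu; exists w.
    by left; split=> //; apply: bD1 uw _.
  by right; split=> //; apply: bD2 wu _.
- by move=> u w w' [uw _ _] [uw' _ _]; apply: (red_bF red uw).
- by move=> u w w' [uw _ _] [uw' _ _]; apply: (red_bI red uw).
- by move=> u v w [uv Du Dv] [vw _ Dw]; split=> //; apply: (red_bT red uv).
Qed.

(** The b-component of a surviving vertex is untouched. The a-edge cut at [x] becomes another a-edge
    of the same weight if [x] and [y] differ, and a loop, which gains one half, if they coincide. *)
Lemma weight_contraction u : ~ D u -> vset G u ->
  weight (contraction D x y G) u =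
  weight G u + (if `[< u = x /\ x = y >] then 2^-1 else 0).
Proof.
move=> nDu Vu; rewrite /weight.
have -> : b_weight (contraction D x y G) u = b_weight G u.
  apply: b_weight_ext => /=; first by split=> [[]|].
  - split=> -[w]; first by case=> uw _ _; exists w.
    by move=> uw; exists w; split=> //; rewrite -(bD uw).
  - split=> -[w]; first by case=> uw _ _; exists w.
    by move=> uw; exists w; split=> //; rewrite (bD uw).
case: asboolP => [[uE xE]|nu].
  rewrite a_weight_loop; last by constructor 2; rewrite -xE.
  rewrite a_weight_edge; first by lra.
  by move=> uu; case: (aD' uu nDu nDu).
rewrite addr0; congr (_ + _ - 1); apply: a_weight_ext => /=.
split=> [[[]//|[ux uy]|[uy ux]]|uu]; last by constructor 1.
- by case: nu; split=> //; rewrite -ux.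
- by case: nu; split=> //; rewrite -ux.
Qed.

Lemma chi_contraction : chi (contraction D x y G) =
  \sum_(u \in vset G `\` D) weight G u + (if x == y then 2^-1 else 0).
Proof.
rewrite /chi /=; have fin : finite_set (vset G `\` D).
  exact/finite_setD/(red_fin red).
rewrite (fsbigD1 x) //= [in RHS](fsbigD1 x) //=.
rewrite weight_contraction // addrAC; congr (_ + _ + _); last first.
  by case: asboolP => [[_ /eqP ->]|nxy] //; case: eqP => // xE; case: nxy.
apply: eq_fsbigr => u; rewrite inE => -[[Vu nDu] /= ux].
by rewrite weight_contraction //; case: asboolP => [[]//|_]; rewrite addr0.
Qed.

End Contraction.

Section DeleteTriangleVertex.
Variables (U : choiceType) (G : graph U) (v w w' : U).
Hypotheses (red : reduced G) (vv : aE G v v) (tri : b_triangle G w v w').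

Let wv : bE G w v. Proof. by case: tri => _ []. Qed.
Let vw' : bE G v w'. Proof. by case: tri => _ []. Qed.
Let w'w : bE G w' w. Proof. by case: tri => _ []. Qed.
Let wDv : w <> v. Proof. by case: tri => -[]. Qed.
Let vDw' : v <> w'. Proof. by case: tri => -[]. Qed.
Let w'Dw : w' <> w. Proof. by case: tri => -[]. Qed.

Let avE u : aE G v u -> u = v.
Proof. by move=> vu; rewrite (red_aF red vu vv). Qed.

(** Unlike a contraction, [lambda21] removes only part of a b-component. The edge from [w'] to [w]
    keeps the two other corners connected and on a b-edge. *)
Lemma reduced_delete_triangle : reduced (delete [set v] G).
Proof.
have [aV aS bV] := red_wf red.
have [[Vw Vv] [_ Vw']] := (bV _ _ wv, bV _ _ vw').
split=> /=.
- split=> /= u u' [uu' uv u'v]; last by case: (bV _ _ uu').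
    by case: (aV _ _ uu').
  by split=> //; apply: aS.
- exact/finite_setD/(red_fin red).
- by exists w.
- move=> P PE u u' [Vu uv] [Vu' u'v] Pu.
  pose Q z := (z <> v /\ P z) \/ (z = v /\ P w).
  have QE z : z <> v -> Q z <-> P z.
    by move=> zv; split=> [[[]//|[]//]|Pz]; left.
  have QD : Q v <-> P w by split=> [[[]//|[]//]|Pz]; right.
  suff : Q u' by move/QE; apply.
  apply: (red_conn red (P := Q) _ Vu Vu'); last exact/QE.
  have Pw : P w' <-> P w by apply: PE; right; split=> // /esym.
  move=> a b ab; have [aE|na] := pselect (a = v);
    have [bE|nb] := pselect (b = v).
  + by rewrite aE bE.
  + rewrite aE in ab *; rewrite QD QE //.
    case: ab => [/avE//|/(red_bF red vw') <-]; exact: iff_sym.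
  + rewrite bE in ab *; rewrite QD QE //.
    by case: ab => [/aS/avE//|/(red_bI red wv) <-].
  + by rewrite !QE //; apply: PE; case: ab => ab; [left|right]; split.
- move=> u [Vu uv]; have [x ux] := red_a red Vu; exists x; split=> // xv.
  by rewrite xv in ux; case: uv; apply: avE (aS _ _ ux).
- by move=> u x x' [ux _ _] [ux' _ _]; apply: red_aF ux ux'.
- move=> u [Vu uv]; have [uE|uw] := pselect (u = w).
    by exists w'; right; rewrite uE; split=> // /esym.
  have [uE|uw'] := pselect (u = w').
    by exists w; left; rewrite uE; split=> // /esym.
  have [x [ux|xu]] := red_b red Vu; exists x; [left|right]; split=> // xv.
    by rewrite xv in ux; apply: uw; apply: red_bI ux wv.
  by rewrite xv in xu; apply: uw'; apply: red_bF xu vw'.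
- by move=> u x x' [ux _ _] [ux' _ _]; apply: red_bF ux ux'.
- by move=> u x x' [ux _ _] [ux' _ _]; apply: red_bI ux ux'.
- by move=> u x x' [ux u1 u2] [xx' _ u3]; split=> //; apply: red_bT ux xx'.
Qed.

(** The lost weight of [v] is 1 + 1/3 - 1 = 1/3; at each of the two other corners the b-weight rises
    from 1/3 to 1/2, a gain of two sixths in total. *)
Lemma chi_delete_triangle : chi (delete [set v] G) = chi G.
Proof.
have [aV aS bV] := red_wf red.
have [[Vw Vv] [_ Vw']] := (bV _ _ wv, bV _ _ vw').
have fin := red_fin red.
have fin1 := finite_setD [set v] fin.
have fin2 := finite_setD [set w] fin1.
rewrite /chi [in RHS](fsbigD1 v) //=.
rewrite (fsbigD1 w) //= [in RHS](fsbigD1 w) //=.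
have w'v : w' <> v by move=> /esym.
rewrite (fsbigD1 w') //= [in RHS](fsbigD1 w') //=.
set s1 := \sum_(_ \in _) _; set s2 := \sum_(_ \in _) _.
have -> : s1 = s2.
  apply: eq_fsbigr => u; rewrite inE => -[[[Vu uv] uw] uw'].
  rewrite /weight; congr (_ + _ - 1).
    by apply: a_weight_ext => /=; split=> [[]|].
  apply: b_weight_ext => /=; first by split=> [[]|].
  + split=> -[x]; first by case=> ux _ _; exists x.
    move=> ux; exists x; split=> // xv; rewrite xv in ux.
    exact/uw/(red_bI red ux wv).
  + split=> -[x]; first by case=> ux _ _; exists x.
    move=> ux; exists x; split=> // xv; rewrite xv in ux.
    exact/uw'/(red_bF red ux vw').
have a_del u : u <> v -> a_weight (delete [set v] G) u = a_weight G u.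
  by move=> uv; apply: a_weight_ext => /=; split=> [[]|].
have iso : isolated_b (delete [set v] G) w' w.
  apply: red_isolated_b; first exact: reduced_delete_triangle.
    by split=> // /esym.
  case=> x [/(red_bF red wv) xE _]; apply.
  by rewrite -xE.
have [b1 b2] := isolated_b_weight iso.
have nl x y : x <> y -> bE G x y -> ~ bE G x x.
  by move=> xDy xy xx; apply: xDy; apply: red_bF xx xy.
rewrite /weight b1 b2 !a_del // ?(a_weight_loop vv).
rewrite !(@b_weight_triangle _ G v w w', @b_weight_triangle _ G w w' v,
  @b_weight_triangle _ G w' v w) //; try exact: nl vw'; try exact: nl wv;
  try exact: nl w'w.
by lra.
Qed.

End DeleteTriangleVertex.

(** The removed weights are 1/2 for [lambda3], 1/2 + 0 for [lambda22] and 0 + 0 for [kappa3]. In the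
    first two cases the new a-loop gains 1/2; in the third nothing is gained. Both sides of [exc]
    have [chi] equal to 1. *)
Lemma move_reduced (U : choiceType) (G G' : graph U) :
  reduced G -> move G G' -> reduced G' /\ chi G' = chi G.
Proof.
move=> red; have [aV aS bV] := red_wf red; have fin := red_fin red.
case=> {G'}.
- move=> v w vv [vDw vw vE wE].
  have [Vv Vw] := aV _ _ vw.
  have wv : ~ [set v] w by move=> /esym.
  have bD u u' : bE G u u' -> [set v] u <-> [set v] u'.
    move=> uu'; split=> /= uE; rewrite uE in uu'.
      by rewrite (red_bF red uu' vv).
    by rewrite (red_bI red uu' vv).
  have aD u u' : aE G u u' -> ~ [set v] u -> [set v] u' <-> u = w \/ u = w.
    move=> uu' _; split=> [/= u'E|[] uE].
    + by left; apply: vE; apply: aS; rewrite -u'E.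
    + by rewrite uE in uu'; apply: wE uu'.
    + by rewrite uE in uu'; apply: wE uu'.
  split; first exact: reduced_contraction.
  rewrite [LHS](chi_contraction red Vw wv bD aD) eqxx.
  rewrite /chi [RHS](fsbigD1 v) //= addrC; congr (_ + _).
  rewrite /weight (b_weight_loop vv) a_weight_edge; first by lra.
  by move=> /(red_aF red vw)/esym.
- move=> v w w' vv tri.
  by split; [apply: reduced_delete_triangle tri|apply: chi_delete_triangle tri].
- move=> v w w' vv iso0 [wDw' ww' wE w'E] w'v w'w.
  have [Vw Vw'] := aV _ _ ww'; have [Vv _] := aV _ _ vv.
  have nD : ~ [set v; w] w' by case.
  have vDw : v <> w by case: iso0 => -[] // wDv _ _ /esym.
  have [wtv wtw] : b_weight G v = 2^-1 /\ b_weight G w = 2^-1.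
    by case: iso0 => iso; have [] := isolated_b_weight iso.
  have bD u u' : bE G u u' -> [set v; w] u <-> [set v; w] u'.
    move=> uu'; split=> -[] uE; rewrite uE in uu';
    case: iso0 => -[_ _ /(_ _ _ uu')] iso; (case: iso; first by
       [constructor 1|constructor 2|constructor 3|constructor 4]);
    by move=> E1 E2; rewrite ?E1 ?E2; rewrite /setU /=; tauto.
  have aD u u' : aE G u u' -> ~ [set v; w] u ->
      [set v; w] u' <-> u = w' \/ u = w'.
    move=> uu' nDu; split=> [[] u'E|uE].
    + case: nDu; left; apply: (red_aF red _ vv).
      by apply: aS; rewrite -u'E.
    + by left; apply: wE; apply: aS; rewrite -u'E.
    + right; apply: w'E; case: uE => uE; by rewrite -uE.
  split; first exact: reduced_contraction.
  rewrite [LHS](chi_contraction red Vw' nD bD aD) eqxx.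
  rewrite /chi [RHS](fsbigD1 v) //= [in RHS](fsbigD1 w) //=; last first.
  - by split=> // /esym.
  - exact: finite_setD.
  rewrite setDDl addrA [RHS]addrC; congr (_ + _).
  rewrite /weight wtv wtw (a_weight_loop vv) a_weight_edge; first by lra.
  by move=> /(red_aF red ww')/esym.
- move=> v w v' w' iso [_ vv' vE v'E] [_ ww' wE w'E].
  move=> [vw vDv' vDw'] [wDv' wDw' vDw''].
  have [Vv Vv'] := aV _ _ vv'; have [Vw Vw'] := aV _ _ ww'.
  have nDv : ~ [set v; w] v' by case=> /esym.
  have nDw : ~ [set v; w] w' by case=> /esym.
  have [wtv wtw] := isolated_b_weight iso.
  have bD u u' : bE G u u' -> [set v; w] u <-> [set v; w] u'.
    move=> uu'; split=> -[] uE; rewrite uE in uu';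
    case: iso => _ _ /(_ _ _ uu') iso; (case: iso; first by
       [constructor 1|constructor 2|constructor 3|constructor 4]);
    by move=> E1 E2; rewrite ?E1 ?E2; rewrite /setU /=; tauto.
  have aD u u' : aE G u u' -> ~ [set v; w] u ->
      [set v; w] u' <-> u = v' \/ u = w'.
    move=> uu' nDu; split=> [[] u'E|[] uE].
    + by left; apply: vE; apply: aS; rewrite -u'E.
    + by right; apply: wE; apply: aS; rewrite -u'E.
    + by left; apply: v'E; rewrite -uE.
    + by right; apply: w'E; rewrite -uE.
  split; first exact: reduced_contraction.
  rewrite [LHS](chi_contraction red Vv' nDv bD aD).
  have /eqP/negPf-> := vDw''.
  rewrite /chi [RHS](fsbigD1 v) //= [in RHS](fsbigD1 w) //=; last first.
  - by split=> // /esym.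
  - exact: finite_setD.
  rewrite setDDl addrA [RHS]addrC; congr (_ + _).
  rewrite /weight wtv wtw !a_weight_edge; first by lra.
  + by move=> /(red_aF red ww')/esym.
  + by move=> /(red_aF red vv')/esym.
- move=> v iso _; rewrite chi_Delta1_at.
  rewrite (chi_iso (red_wf red) wf_Delta3 iso) chi_Delta3; split=> //.
  split=> //=; first exact: wf_Delta1_at.
  + by exists v.
  + by move=> P _ x y -> ->.
  + by move=> x ->; exists v.
  + by move=> x y z [_ ->] [_ ->].
  + by move=> x ->; exists v; left.
  + by move=> x y z [_ ->] [_ ->].
  + by move=> x y z [-> _] [-> _].
  + by move=> x y z [-> _] [_ ->].
Qed.

Lemma silhouette_reduced (U : choiceType) (G S : graph U) :
  reduced G -> silhouette G S -> reduced S /\ chi S = chi G.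
Proof.
move=> redG [GS _]; elim: GS redG => {G S} [G G' m red||G G1 G2 _ h1 _ h2 red].
- exact: move_reduced.
- by [].
- have [red1 <-] := h1 red; exact: h2.
Qed.

(** * Graphs to which no move applies *)

Section Terminal.
Variables (U : choiceType) (G : graph U).
Hypotheses (red : reduced G) (term : ~ exists G', move G G').

Let aV x y : aE G x y -> vset G x /\ vset G y.
Proof. by have [h _ _] := red_wf red; apply: h. Qed.
Let aS x y : aE G x y -> aE G y x.
Proof. by have [_ h _] := red_wf red; apply: h. Qed.
Let bV x y : bE G x y -> vset G x /\ vset G y.
Proof. by have [_ _ h] := red_wf red; apply: h. Qed.

(** If the a-edge at [v] were not a loop, [lambda3] would apply; with both loops at [v] no edge
    leaves it, and connectivity excludes other vertices. *)
Lemma terminal_b_loop v : bE G v v -> graph_iso G Delta1.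
Proof.
move=> vv; have [Vv _] := bV vv; have [w vw] := red_a red Vv.
have [wE|vDw] := pselect (v = w); last first.
  case: term; exists (add_a w w (delete [set v] G)).
  exact/lambda3/red_isolated_a.
subst w.
have VE x : vset G x -> x = v.
  move=> Vx; apply: (red_conn red (P := fun x => x = v) _ Vv Vx erefl).
  move=> y z [yz|yz]; split=> E; rewrite E in yz.
  - by rewrite (red_aF red yz vw).
  - by rewrite (red_aF red (aS yz) vw).
  - by rewrite (red_bF red yz vv).
  - by rewrite (red_bI red yz vv).
exists (fun=> tt); split; first split=> //.
- by move=> x y /set_mem/VE-> /set_mem/VE->.
- by move=> [] _; exists v.
- by move=> x y /VE-> /VE->.
Qed.

(** Shared by [Delta2] and [Delta3]: no edge leaves the pair [v], [w], so by connectivity it is the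
    whole vertex set, sent to [false], [true]. *)
Lemma isolated_b_iso v w (D : graph bool) : isolated_b G v w ->
  (forall x y, aE G x y -> ([set v; w] x <-> [set v; w] y)) ->
  vset D = [set: bool] -> (forall x y, bE D x y <-> x = false /\ y = true) ->
  (forall x y : bool,
    aE D x y <-> aE G (if x then w else v) (if y then w else v)) ->
  vset G v /\ graph_iso G D.
Proof.
case=> vDw vw iso aI VD bD aD; have [Vv Vw] := bV vw; split=> //.
have VE x : vset G x -> x = v \/ x = w.
  move=> Vx; apply: (red_conn red (P := [set v; w]) _ Vv Vx); last by left.
  move=> y z [/aI //|yz]; split=> -[] E; (have [|yE zE] := iso _ _ yz;
    [by [constructor 1|constructor 2|constructor 3|constructor 4]|
     by [left|right]]).
have wv : (v == w) = false by apply/eqP.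
pose f x := x == w; have fK x : vset G x -> (if f x then w else v) = x.
  by move=> /VE[]->; rewrite /f ?wv ?eqxx.
exists f; split; first split.
- by move=> x _; rewrite /= VD.
- by move=> x y /set_mem/fK{2}<- /set_mem/fK{2}<- ->.
- by move=> b _; exists (if b then w else v); case: b; rewrite /f ?wv ?eqxx.
- move=> x y Vx Vy; rewrite aD bD !fK //; split=> //; split.
    by move=> xy; have [|-> ->] := iso _ _ xy; rewrite /f ?wv ?eqxx //;
       case: (VE _ Vx) => ->; [constructor 1|constructor 2].
  by case: (VE _ Vx) (VE _ Vy) => -> [] ->; rewrite /f ?wv ?eqxx // => -[].
Qed.

(** Without a b-loop at [v], a triangle would allow [lambda21]. For an isolated b-edge, either
    [lambda22] applies or its other end carries an a-loop too, and then the graph is [Delta3] and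
    [exc] applies. *)
Lemma terminal_a_loop v : aE G v v -> graph_iso G Delta1.
Proof.
move=> vv; have [Vv _] := aV vv.
have [vb|nvb] := pselect (bE G v v); first exact: terminal_b_loop vb.
have isoE w : isolated_b G v w \/ isolated_b G w v -> aE G w w.
  move=> iso; have vDw : v <> w by case: iso => -[] // wDv _ _ /esym.
  have Vw : vset G w by case: iso => -[_ /bV[Vx Vy] _].
  have [w' ww'] := red_a red Vw.
  have [w'E|w'Dw] := pselect (w' = w); first by rewrite w'E in ww'.
  case: term; exists (add_a w' w' (delete [set v; w] G)).
  apply: (lambda22 vv iso); [exact: red_isolated_a (nesym w'Dw) ww'| |by []].
  by move=> w'E; apply: vDw; rewrite w'E in ww';
    apply: (red_aF red vv (aS ww')).
have no3 u w : isolated_b G u w -> aE G u u -> aE G w w -> False.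
  move=> iso uu ww; have [/eqP/negPf uDw _ _] := iso.
  have [||||Vu D3] := isolated_b_iso (D := Delta3) iso.
  - move=> x y xy; split=> -[] E; rewrite E in xy.
    + by left; apply: (red_aF red xy uu).
    + by right; apply: (red_aF red xy ww).
    + by left; apply: (red_aF red (aS xy) uu).
    + by right; apply: (red_aF red (aS xy) ww).
  - by [].
  - by [].
  - move=> [] [] /=; split=> // xy; have := uDw.
    + by rewrite (red_aF red xy ww) eqxx.
    + by rewrite (red_aF red xy uu) eqxx.
  - by case: term; exists (Delta1_at u); apply: exc D3 Vu.
have [[w vw]|nout] := pselect (exists w, bE G v w); last first.
  have [w [vw|wv]] := red_b red Vv; first by case: nout; exists w.
  have iso := red_isolated_b red wv nout.
  by case: (no3 _ _ iso) => //; apply: isoE; right.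
have vDw : v <> w by move=> E; apply: nvb; rewrite {2}E.
have [[x wx]|nout] := pselect (exists x, bE G w x).
  case: term; exists (delete [set v] G); apply: lambda21 vv _.
  apply: (red_b_triangle red (red_bT red vw wx) vw).
  by move=> xE; apply: nvb; rewrite xE in wx; apply: (red_bT red vw wx).
have iso := red_isolated_b red vw nout.
by case: (no3 _ _ iso) => //; apply: isoE; left.
Qed.

(** If the a-edges at [v] and [w] are distinct, [kappa3] applies; otherwise a single a-edge joins
    [v] to [w], and the graph closes up to [Delta2]. *)
Lemma terminal_isolated_b v w : isolated_b G v w ->
  (forall u, ~ aE G u u) -> graph_iso G Delta2.
Proof.
move=> iso nl; have [vDw vw isoE] := iso; have [Vv Vw] := bV vw.
have [v' vv'] := red_a red Vv; have [w' ww'] := red_a red Vw.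
have nE x y : aE G x y -> x <> y by move=> xy E; rewrite E in xy; apply: nl xy.
have [v'E|v'Dw] := pselect (v' = w).
  subst v'; have wv := aS vv'.
  have [||||] := isolated_b_iso (D := Delta2) iso => //.
  - move=> x y xy; split=> -[] E; rewrite E in xy.
    + by right; apply: (red_aF red xy vv').
    + by left; apply: (red_aF red xy wv).
    + by right; apply: (red_aF red (aS xy) vv').
    + by left; apply: (red_aF red (aS xy) wv).
  - by move=> [] []; split=> //= /nl.
case: term; exists (add_a v' w' (delete [set v; w] G)).
apply: kappa3 => //; try exact: red_isolated_a (nE _ _ _) _.
- split=> //; first exact: nE.
  by move=> E; apply: v'Dw; rewrite -E in ww'; apply: red_aF vv' (aS ww').
- split; [by move/esym|exact: nE|move=> E; apply: vDw].
  by rewrite -E in ww'; apply: red_aF (aS vv') (aS ww').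
Qed.

Lemma terminal_cases :
  [\/ graph_iso G Delta1, graph_iso G Delta2 | chi G < 0].
Proof.
have [[v vv]|na] := pselect (exists v, aE G v v).
  by constructor 1; apply: terminal_a_loop vv.
have [[v vv]|nb] := pselect (exists v, bE G v v).
  by constructor 1; apply: terminal_b_loop vv.
have [[v [w iso]]|ni] := pselect (exists v w, isolated_b G v w).
  constructor 2; apply: (terminal_isolated_b iso) => u uu.
  by apply: na; exists u.
constructor 3; have [v Vv] := red_neq0 red.
have neg u : vset G u -> weight G u < 0.
  move=> Vu; rewrite /weight a_weight_edge; last first.
    by move=> uu; apply: na; exists u.
  have nbu : ~ bE G u u by move=> uu; apply: nb; exists u.
  (* Without isolated b-edges every b-edge can be continued, and [red_bT] closes up two successive
     ones, so each vertex has b-edges in both directions. *)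
  have ex x y : bE G x y -> exists z, bE G y z.
    move=> xy; apply: contrapT => no; apply: ni; exists x, y.
    exact: red_isolated_b.
  suff [x [y [xu uy]]] : exists x y, bE G x u /\ bE G u y.
    by rewrite (b_weight_triangle nbu xu uy); lra.
  have [x [ux|xu]] := red_b red Vu.
    by have [y xy] := ex _ _ ux; exists y, x; split=> //; apply: red_bT ux xy.
  by have [y uy] := ex _ _ xu; exists x, y.
rewrite /chi (fsbigD1 v) //=; last exact: red_fin.
rewrite -[ltRHS](addr0 0); apply: ltr_leD; first exact: neg.
by apply: fsumr_le0 => u [/neg/ltW].
Qed.

End Terminal.

(** * Averaging projections and their ranks *)

(** Factor [P = C *m R] through its rank. Cancelling [C] and [R] in [P *m P = P] gives [R *m C = 1],
    and the trace of [C *m R] is that of [R *m C]. *)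
Lemma mxrank_idempotent (F : fieldType) (n : nat) (P : 'M[F]_n) :
  P *m P = P -> (\rank P)%:R = \tr P.
Proof.
move=> PP; have CR := mulmx_base P.
move: CR (row_base_free P) (col_base_full P).
move: (col_base P) (row_base P) => C R CR freeR fullC.
suff RC : R *m C = 1%:M by rewrite -CR mxtrace_mulC RC mxtrace1 CR.
apply: (row_free_inj freeR); apply: (row_full_inj fullC).
by rewrite mul1mx CR !mulmxA CR -mulmxA CR.
Qed.

Section Averaging.
Variables (n : nat) (e : rel 'I_n).
Hypothesis eqv : equivalence_rel e.

(** The projection, acting on row vectors from the right, that averages over the classes of [e]; its
    row space consists of the vectors constant on classes. *)
Definition avg_mx : 'M[rat]_n :=
  \matrix_(i, j) if e i j then (#|e i|%:R)^-1 else 0.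

Let exx i : e i i. Proof. by case: (eqv i i i). Qed.
Let eqr i j k : e i j -> e i k = e j k.
Proof. by case: (eqv i j k) => _ /[apply]. Qed.
Let esym i j : e i j = e j i.
Proof. by apply/idP/idP => ij; [rewrite -(eqr _ ij)|rewrite -(eqr _ ij)]. Qed.

Lemma mul_avg_mx (u : 'rV[rat]_n) :
  (forall i j, e i j -> u 0 i = u 0 j) -> u *m avg_mx = u.
Proof.
move=> uE; apply/rowP => i; rewrite mxE.
transitivity (\sum_(k | e i k) u 0 i / #|e i|%:R).
  rewrite [RHS]big_mkcond; apply: eq_bigr => k _; rewrite mxE esym.
  case: ifP => ik; last by rewrite mulr0.
  rewrite -(uE _ _ ik); congr (_ / _%:R).
  by apply: eq_card => j; rewrite -!topredE /= (eqr _ ik).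
rewrite sumr_const -[LHS]mulr_natr; apply: divfK; rewrite pnatr_eq0 -lt0n.
by apply/card_gt0P; exists i; apply: exx.
Qed.

Lemma sub_avg_mx (u : 'rV[rat]_n) :
  reflect (forall i j, e i j -> u 0 i = u 0 j) (u <= avg_mx)%MS.
Proof.
apply: (iffP idP) => [/submxP[v ->] i j ij|uE]; last first.
  by rewrite -(mul_avg_mx uE) submxMl.
rewrite !mxE; apply: eq_bigr => k _; rewrite !mxE.
by rewrite ![e k _]esym (eqr _ ij).
Qed.

(** The matrix is idempotent, so its rank is its trace, which adds up the inverse class sizes. *)
Lemma rank_avg_mx : (\rank avg_mx)%:R = \sum_i (#|e i|%:R)^-1 :> rat.
Proof.
rewrite mxrank_idempotent; last first.
  apply/row_matrixP => i; rewrite row_mul mul_avg_mx // => j k jk.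
  by apply: (elimT (sub_avg_mx _) _ _ _ jk); apply: row_sub.
by apply: eq_bigr => i _; rewrite mxE exx.
Qed.

End Averaging.

(** * Potentials on [PSL2Z] *)

Section PSL2Z.

Lemma psl_aa : (psl_a * psl_a = 1)%g.
Proof.
rewrite /psl_a /pgen [LHS]pmulE; apply/pclassP.
by apply: (@pres_relator _ _ [::] [::] (nseq 2 (false, true))); left.
Qed.

Lemma psl_bbb : (psl_b * psl_b * psl_b = 1)%g.
Proof.
rewrite /psl_b /pgen [X in (X * _)%g]pmulE [LHS]pmulE; apply/pclassP.
by apply: (@pres_relator _ _ [::] [::] (nseq 3 (true, true))); right.
Qed.

Lemma psl_aV : (psl_a^-1 = psl_a)%g.
Proof. by apply: mulg1_eq; exact: psl_aa. Qed.

Lemma psl_bV : (psl_b^-1 = psl_b * psl_b)%g.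
Proof. by apply: mulg1_eq; rewrite mulgA psl_bbb. Qed.

Lemma pclass_nil : pclass psl_relators [::] = (1 : PSL2Z)%g.
Proof. by []. Qed.

Definition sgen (l : bool * bool) : PSL2Z :=
  let s := if l.1 then psl_b else psl_a in if l.2 then s else (s^-1)%g.

Lemma pclass_sgen l : pclass psl_relators [:: l] = sgen l.
Proof. by case: l => -[] [] //=; rewrite /sgen /= [RHS]ppinvE. Qed.

Lemma pclass_rcons w l :
  pclass psl_relators (rcons w l) = (pclass psl_relators w * sgen l)%g.
Proof. by rewrite -pclass_sgen [RHS]pmulE cats1. Qed.

(** Right multiplications by the generators suffice because their inverses are positive powers. *)
Lemma psl_ind (P : PSL2Z -> Prop) : P 1%g ->
  (forall g, P g -> P (g * psl_a)%g) -> (forall g, P g -> P (g * psl_b)%g) ->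
  forall g, P g.
Proof.
move=> P1 Pa Pb g; rewrite -(pclass_repr g).
elim/last_ind: (repr g) => [//|w [x e] IH]; rewrite pclass_rcons /sgen /=.
case: x e => -[]; rewrite ?psl_bV ?psl_aV ?mulgA;
  [exact: Pb| |exact: Pa|exact: Pa].
by apply/Pb/Pb.
Qed.

Lemma psl_const (E : PSL2Z -> rat) :
  (forall g, E (g * psl_a)%g = E g) -> (forall g, E (g * psl_b)%g = E g) ->
  forall g, E g = E 1%g.
Proof. by move=> Ea Eb; apply: psl_ind => // g <-. Qed.

Section Potential.
Variable f : PSL2Z -> rat.

(** The word is read as a path from [g] in the Cayley graph; only its a-edges contribute, by the
    increments of [f]. *)
Fixpoint wsum g (w : pword bool) : rat :=
  if w is l :: w' then
    (if l.1 then 0 else f (g * sgen l)%g - f g) + wsum (g * sgen l)%g w'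
  else 0.

Lemma wsum_cat g u v :
  wsum g (u ++ v) = wsum g u + wsum (g * pclass psl_relators u)%g v.
Proof.
elim: u g => [|l u IH] g /=; first by rewrite add0r pclass_nil mulg1.
rewrite IH addrA -mulgA; congr (_ + wsum (g * _)%g v).
by rewrite -pclass_sgen [LHS]pmulE.
Qed.

(** The increments along [a a], or along a letter and its inverse, cancel, and b-letters contribute
    nothing; so the sum depends only on [g] and on the group element represented. *)
Lemma wsum_pres_eq u v :
  pres_eq psl_relators u v -> forall g, wsum g u = wsum g v.
Proof.
have ins w1 s w2 g : pclass psl_relators s = (1 : PSL2Z)%g ->
    (forall h, wsum h s = 0) -> wsum g (w1 ++ s ++ w2) = wsum g (w1 ++ w2).
  by move=> s1 s0; rewrite !wsum_cat s1 s0 add0r mulg1.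
elim=> {u v} [//|u v _ IH g//|u v w _ h1 _ h2 g|u v x e g|u v s Rs g].
- by rewrite h1.
- apply: ins => [|h].
    by apply/pclassP; apply: (@pres_cancel _ _ [::] [::]).
  have E : (sgen (x, e) * sgen (x, ~~ e) = 1)%g.
    by case: x e => -[]; rewrite /sgen /= ?mulgV ?mulVg.
  by rewrite /= -!mulgA E mulg1; case: x {E} => /=; ring.
- apply: ins => [|h].
    apply/pclassP; rewrite -(cats0 s).
    exact: (@pres_relator _ _ [::] [::] s Rs).
  case: Rs => -> /=; rewrite /sgen /= ?add0r //.
  by rewrite -!mulgA psl_aa mulg1; ring.
Qed.

Definition potential (g : PSL2Z) : rat := wsum 1%g (repr g).

Lemma potential_pclass w : potential (pclass psl_relators w) = wsum 1%g w.
Proof. exact/wsum_pres_eq/pres_repr. Qed.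

Lemma potential1 : potential 1%g = 0.
Proof. exact: (potential_pclass [::]). Qed.

Lemma potential_a g :
  potential (g * psl_a)%g = potential g + (f (g * psl_a)%g - f g).
Proof.
rewrite -{1}(pclass_repr g) [(_ * _)%g]pmulE potential_pclass wsum_cat /=.
by rewrite addr0 mul1g pclass_repr.
Qed.

Lemma potential_b g : potential (g * psl_b)%g = potential g.
Proof.
rewrite -{1}(pclass_repr g) [(_ * _)%g]pmulE potential_pclass wsum_cat /=.
by rewrite !addr0.
Qed.

End Potential.

End PSL2Z.

(** * Geodesic words, Schreier graphs and Stallings graphs *)

(** Where alternation fails at the new head, two letters [La] cancel, and two b-letters cancel or
    merge into one. *)
Lemma geodesic_consP l w : geodesic w ->
  exists w', geodesic w' /\ word_val w' = (letter_val l * word_val w)%g.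
Proof.
case: w => [|l' w] gw; first by exists [:: l].
have gt : geodesic w by move: gw; rewrite /geodesic /=; apply: path_sorted.
have switch l2 : is_a l2 = is_a l' -> geodesic (l2 :: w).
  by move=> E; move: gw; rewrite /geodesic /=;
    case: w {gt} => //= x w; rewrite E.
have [ll'|] := boolP (is_a l != is_a l').
  by exists (l :: l' :: w); split=> //; rewrite /geodesic /= ll'.
case: l l' gw switch => -[] // gw switch _; rewrite /= mulgA.
- by exists w; rewrite psl_aa mul1g.
- exists (LB :: w); split; first exact: switch.
  by rewrite /= psl_bV.
- by exists w; rewrite mulgV mul1g.
- by exists w; rewrite mulVg mul1g.
- exists (Lb :: w); split; first exact: switch.
  by rewrite /= psl_bV mulgA psl_bbb mul1g.
Qed.

Lemma geodesic_exists (g : PSL2Z) : exists w, geodesic w /\ word_val w = g.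
Proof.
have mulP h l : (exists w, geodesic w /\ word_val w = h) ->
    exists w, geodesic w /\ word_val w = (letter_val l * h)%g.
  by case=> w [gw <-]; apply: geodesic_consP.
(* [psl_ind] multiplies on the right whereas geodesics grow on the left, hence the passage to
   inverses. *)
rewrite -(invgK g); move: (g^-1)%g => {g}; apply: psl_ind.
- by exists [::]; rewrite invg1.
- by move=> g /(mulP _ La); rewrite invgM psl_aV.
- by move=> g /(mulP _ LB); rewrite invgM.
Qed.

Lemma walk_cat U (G : graph U) x p y q z :
  walk G x p y -> walk G y q z -> walk G x (p ++ q) z.
Proof.
elim: p x => [|l p IH] x /= => [-> //|[t [xt ty]] yz].
by exists t; split=> //; apply: IH.
Qed.

Lemma word_val_cat p q : word_val (p ++ q) = (word_val p * word_val q)%g.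
Proof. by elim: p => [|l p IH] /=; rewrite ?mul1g // IH mulgA. Qed.

Section Schreier.
Variable K : set PSL2Z.
Hypothesis Ksub : is_subgroup K.

Let K1 : K 1%g. Proof. by case: Ksub. Qed.
Let KV x : K x -> K (x^-1)%g.
Proof. by move=> Kx; rewrite -(mul1g (x^-1)%g); apply: (Ksub.2 _ _ K1 Kx). Qed.
Let KM x y : K x -> K y -> K (x * y)%g.
Proof.
by move=> Kx Ky; rewrite -(invgK y); apply: (Ksub.2 _ _ Kx); apply: KV.
Qed.

Lemma rcoset_setM k g : K k -> rcoset_set K (k * g)%g = rcoset_set K g.
Proof.
move=> Kk; apply/seteqP; split=> x [h Kh <-].
  by exists (h * k)%g; [apply: KM|rewrite mulgA].
by exists (h * k^-1)%g; [apply/KM/KV|rewrite -mulgA mulKg].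
Qed.

Lemma rcoset_set_self g : rcoset_set K g g.
Proof. by exists 1%g => //; rewrite mul1g. Qed.

Lemma rcoset_set1 : rcoset_set K 1%g = K.
Proof.
apply/seteqP; split=> x; first by case=> h Kh <-; rewrite mulg1.
by move=> Kx; exists x => //; rewrite mulg1.
Qed.

Lemma rcoset_set_eq g h : rcoset_set K g = rcoset_set K h ->
  exists2 k, K k & g = (k * h)%g.
Proof.
by move=> E; have := rcoset_set_self g; rewrite E => -[k Kk <-]; exists k.
Qed.

Lemma schreier_edge g l :
  edge (schreier K) l (rcoset_set K g) (rcoset_set K (g * letter_val l)%g).
Proof.
case: l => /=; first by exists g; left.
  by exists g.
by exists (g * psl_b^-1)%g; rewrite mulgVK.
Qed.

Lemma schreier_walk g w :
  walk (schreier K) (rcoset_set K g) w (rcoset_set K (g * word_val w)%g).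
Proof.
elim: w g => [|l w IH] g /=; first by rewrite mulg1.
exists (rcoset_set K (g * letter_val l)%g); split; first exact: schreier_edge.
by rewrite mulgA.
Qed.

(** Every word can be read from every vertex of the Schreier graph. A geodesic word with value in
    [K] leads from [K] back to [K], so each of its letters crosses an edge of the Stallings
    graph. *)
Lemma stallings_crossed p l q : geodesic (p ++ l :: q) ->
  K (word_val (p ++ l :: q)) ->
  crossed K l (rcoset_set K (word_val p))
              (rcoset_set K (word_val p * letter_val l)%g).
Proof.
move=> gw Kw.
have wK : rcoset_set K (word_val (p ++ l :: q)) = K.
  by rewrite -[X in rcoset_set K X]mulg1 rcoset_setM // rcoset_set1.
have from1 w : walk (schreier K) K w (rcoset_set K (word_val w)).
  by have := schreier_walk 1%g w; rewrite rcoset_set1 mul1g.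
exists p, q; split.
- by split=> //; have := from1 (p ++ l :: q); rewrite wK.
- exact: from1.
- exact: schreier_edge.
- have := schreier_walk (word_val p * letter_val l)%g q.
  have -> : (word_val p * letter_val l * word_val q = word_val (p ++ l :: q))%g.
    by rewrite word_val_cat /= mulgA.
  by rewrite wK.
Qed.

(* Every element of K is read along a geodesic loop, which stays in the
   Stallings graph. *)
Lemma stallings_const (E : PSL2Z -> rat) :
  (forall g, aE (stallings K) (rcoset_set K g) (rcoset_set K (g * psl_a)%g) ->
     E (g * psl_a)%g = E g) ->
  (forall g, bE (stallings K) (rcoset_set K g) (rcoset_set K (g * psl_b)%g) ->
     E (g * psl_b)%g = E g) ->
  forall k, K k -> E k = E 1%g.
Proof.
move=> Ea Eb k Kk; have [w [gw wk]] := geodesic_exists k; rewrite -wk in Kk *.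
suff H p q : w = p ++ q -> E (word_val p) = E 1%g.
  by apply: (H w [::]); rewrite cats0.
elim/last_ind: p q => [//|p l IH] q; rewrite cat_rcons => wE.
rewrite -(IH _ wE) -cats1 word_val_cat /= mulg1.
rewrite wE in gw Kk; have := stallings_crossed gw Kk.
case: l {IH wE gw Kk} => /= cr; first by apply: Ea; left.
  by apply: Eb; left.
(* A letter [LB] traverses a b-edge backwards, so the invariance of [E] is applied at its other
   end. *)
rewrite -{2}(mulgVK psl_b (word_val p)); apply/esym/Eb; right.
by rewrite mulgVK.
Qed.

Lemma stallings_aE x y : aE (stallings K) x y ->
  exists g, x = rcoset_set K g /\ y = rcoset_set K (g * psl_a)%g.
Proof.
have ga g : (g * psl_a * psl_a = g)%g by rewrite -mulgA psl_aa mulg1.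
case=> -[p [q [_ _ /= [g [][-> ->]] _]]];
  by [exists g|exists (g * psl_a)%g; rewrite ga].
Qed.

Lemma stallings_bE x y : bE (stallings K) x y ->
  exists g, x = rcoset_set K g /\ y = rcoset_set K (g * psl_b)%g.
Proof. by case=> -[p [q [_ _ /= [g [-> ->]] _]]]; exists g. Qed.

End Schreier.

Lemma crossed_on_loop K l x y : crossed K l x y -> on_loop K x /\ on_loop K y.
Proof.
case=> p [q [gl Kp xy yK]]; split.
  by exists p, (l :: q); split=> //; exists y.
exists (rcons p l), q; rewrite cat_rcons; split=> //.
by rewrite -cats1; apply: walk_cat Kp _; exists y.
Qed.

Lemma wf_stallings K : wf_graph (stallings K).
Proof.
split=> x y /=.
- by case=> /crossed_on_loop[].
- by case; [right|left].
- by case=> /crossed_on_loop[].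
Qed.

(** * Homomorphisms from a free product to the rationals *)

Section FreeProduct.
Variables r2 r3 r : nat.
Local Notation FP := (free_product r2 r3 r).
Local Notation rels := (fprod_relators r2 r3 r).

Lemma free_product_ind (P : FP -> Prop) :
  P 1%g -> (forall g h, P g -> P h -> P (g * h)%g) ->
  (forall g, P g -> P (g^-1)%g) -> (forall x, P (pgen rels x)) -> forall g, P g.
Proof.
move=> P1 PM PV Px g; rewrite -(pclass_repr g).
elim: (repr g) => [//|[x e] w IH].
have -> : pclass rels ((x, e) :: w) =
    (pclass rels [:: (x, e)] * pclass rels w : FP)%g.
  by rewrite [RHS]pmulE.
apply: PM => //; case: e; first exact: Px.
have -> : pclass rels [:: (x, false)] = ((pgen rels x)^-1 : FP)%g.
  by rewrite [RHS]ppinvE.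
exact/PV/Px.
Qed.

(** The rationals are torsion-free, so the generators of order 2 and 3 are killed and the free
    generators determine a homomorphism. *)
Lemma free_product_hom0 (theta : FP -> rat) :
  {morph theta : x y / (x * y)%g >-> x + y} ->
  (forall k, theta (pgen rels (inr k)) = 0) -> forall g, theta g = 0.
Proof.
move=> thM th0.
have th1 : theta 1%g = 0.
  by have := thM 1%g 1%g; rewrite mulg1; lra.
apply: free_product_ind => //.
- by move=> g h thg thh; rewrite thM thg thh addr0.
- by move=> g thg; have := thM g (g^-1)%g; rewrite mulgV th1 thg add0r.
case=> [[i|j]|k //].
- set x := pgen rels (inl (inl i)).
  have E : (x * x = 1 :> FP)%g.
    rewrite [LHS]pmulE; apply/pclassP.
    apply: (@pres_relator _ rels [::] [::] (nseq 2 (inl (inl i), true))).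
    by left; exists i.
  by have := thM x x; rewrite E th1; lra.
- set y := pgen rels (inl (inr j)).
  have E : (y * (y * y) = 1 :> FP)%g.
    rewrite [X in (_ * X)%g]pmulE [LHS]pmulE; apply/pclassP.
    apply: (@pres_relator _ rels [::] [::] (nseq 3 (inl (inr j), true))).
    by right; exists j.
  by have := thM y (y * y)%g; rewrite E th1 thM; lra.
Qed.

Variable t : 'I_r -> rat.

Definition exponent (l : ('I_r2 + 'I_r3 + 'I_r) * bool) : rat :=
  if l.1 is inr k then (if l.2 then t k else - t k) else 0.

Definition exponent_sum (w : seq (('I_r2 + 'I_r3 + 'I_r) * bool)) : rat :=
  \sum_(l <- w) exponent l.

Lemma exponent_sum_pres_eq u v :
  pres_eq rels u v -> exponent_sum u = exponent_sum v.
Proof.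
rewrite /exponent_sum; elim=> {u v} // [u v w _ -> _ -> //|u v x e|u v s Rs].
  have E : exponent (x, e) + exponent (x, ~~ e) = 0.
    by case: x e => [x|k] [] //=; rewrite /exponent /= ?addr0 ?addNr ?addrN.
  by rewrite !big_cat !big_cons big_nil /= addr0 E add0r.
rewrite !big_cat /=; suff -> : \sum_(l <- s) exponent l = 0 by rewrite add0r.
by case: Rs => -[i _ <-]; rewrite /= !big_cons big_nil /exponent /= !addr0.
Qed.

(** The homomorphism with the arbitrary values [t] at the free generators and 0 at the torsion
    generators. *)
Definition fp_hom (g : FP) : rat := exponent_sum (repr g).

Lemma fp_hom_pclass w : fp_hom (pclass rels w) = exponent_sum w.
Proof. exact/exponent_sum_pres_eq/pres_repr. Qed.

Lemma fp_homM : {morph fp_hom : x y / (x * y)%g >-> x + y}.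
Proof.
move=> x y; rewrite -{1}(pclass_repr x) -{1}(pclass_repr y) [(_ * _)%g]pmulE.
by rewrite fp_hom_pclass /exponent_sum big_cat.
Qed.

Lemma fp_hom_gen k : fp_hom (pgen rels (inr k)) = t k.
Proof. by rewrite fp_hom_pclass /exponent_sum big_seq1. Qed.

End FreeProduct.

(** * The dimension of the space of homomorphisms from [K] to the rationals *)

Section HomDimension.
Variables (U : choiceType) (G : graph U) (s : seq U).
Variables (K : set PSL2Z) (f : U -> set PSL2Z) (r2 r3 r : nat).
Variable F : {multiplicative free_product r2 r3 r -> PSL2Z}.
Hypotheses (red : reduced G) (us : uniq s) (sV : vset G = [set` s]).
Hypotheses (Ksub : is_subgroup K) (fiso : iso_by f G (stallings K)).
Hypotheses (Finj : injective F) (FK : range F = K).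

Local Notation n := (size s).
Local Notation z k := (pgen (fprod_relators r2 r3 r) (inr k)).
Let vx (i : 'I_n) : U := tnth (in_tuple s) i.
Let vert i : set PSL2Z := f (vx i).

Let Vvx i : vset G (vx i). Proof. by rewrite sV /=; apply: mem_tnth. Qed.

Let vx_inj : injective vx.
Proof. by apply/tuple_uniqP. Qed.

Let vx_surj v : vset G v -> exists i, v = vx i.
Proof.
rewrite sV /= => vs.
by have /tnthP[i ->] : v \in in_tuple s by []; exists i.
Qed.

Let vert_inj : injective vert.
Proof.
have [[_ fI _] _] := fiso; move=> i j E; apply: vx_inj.
by apply: fI E; rewrite inE.
Qed.

Let vert_surj x : on_loop K x -> exists i, x = vert i.
Proof.
have [[_ _ fS] _] := fiso.
by move=> /fS[v /vx_surj[i ->] <-]; exists i.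
Qed.

Let vert_aE i j : aE G (vx i) (vx j) <-> aE (stallings K) (vert i) (vert j).
Proof. by have [_ fE] := fiso; have [] := fE _ _ (Vvx i) (Vvx j). Qed.

Let vert_bE i j : bE G (vx i) (vx j) <-> bE (stallings K) (vert i) (vert j).
Proof. by have [_ fE] := fiso; have [] := fE _ _ (Vvx i) (Vvx j). Qed.

Let aS x y : aE G x y -> aE G y x.
Proof. by have [_ h _] := red_wf red; apply: h. Qed.

Definition a_rel : rel 'I_n := fun i j => (i == j) || `[< aE G (vx i) (vx j) >].
Definition b_rel : rel 'I_n := fun i j =>
  (i == j) || `[< bE G (vx i) (vx j) \/ bE G (vx j) (vx i) >].

Let a_relP i j : reflect (i = j \/ aE G (vx i) (vx j)) (a_rel i j).
Proof.
apply: (iffP orP) => -[].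
- by move/eqP; left.
- by move/asboolP; right.
- by move/eqP; left.
- by move/asboolP; right.
Qed.

Let b_relP i j :
  reflect [\/ i = j, bE G (vx i) (vx j) | bE G (vx j) (vx i)] (b_rel i j).
Proof.
apply: (iffP orP) => -[].
- by move/eqP; constructor 1.
- by move/asboolP => -[]; [constructor 2|constructor 3].
- by move/eqP; left.
- by move=> h; right; apply/asboolP; left.
- by move=> h; right; apply/asboolP; right.
Qed.

Lemma a_rel_eqv : equivalence_rel a_rel.
Proof.
apply/equivalence_relP; split; first by move=> i; rewrite /a_rel eqxx.
apply: sym_left_transitive => [i j|j i k /a_relP ij /a_relP jk].
  by apply/a_relP/a_relP => -[->|/aS]; [left|right|left|right].
apply/a_relP; case: ij => [->//|ij]; case: jk => [<-|jk]; first by right.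
by left; apply: vx_inj; apply: (red_aF red (aS ij) jk).
Qed.

Lemma b_rel_eqv : equivalence_rel b_rel.
Proof.
apply/equivalence_relP; split; first by move=> i; rewrite /b_rel eqxx.
apply: sym_left_transitive => [i j|j i k /b_relP ij /b_relP jk].
  by apply/b_relP/b_relP => -[->||];
    [constructor 1|constructor 3|constructor 2|
     constructor 1|constructor 3|constructor 2].
apply/b_relP; case: ij => [->//|ij|ji]; case: jk => [<-|jk|kj].
- by constructor 2.
- by constructor 3; apply: (red_bT red ij jk).
- by constructor 1; apply: vx_inj; apply: (red_bI red ij kj).
- by constructor 3.
- by constructor 1; apply: vx_inj; apply: (red_bF red ji jk).
- by constructor 2; apply: (red_bT red kj ji).
Qed.

(** The class of [i] consists of the two ends, possibly equal, of its a-edge. This ties the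
    averaging matrices to [chi]. *)
Lemma card_a_rel i : (#|a_rel i|%:R)^-1 = a_weight G (vx i).
Proof.
have [w iw] := red_a red (Vvx i).
have [j wE] : exists j, w = vx j.
  by apply: vx_surj; have [aV _ _] := red_wf red; case: (aV _ _ iw).
rewrite wE in iw; rewrite (@eq_card _ _ (pred2 i j)); last first.
  move=> k; rewrite -!topredE /=; apply/a_relP/orP => -[].
  - by move=> ->; left.
  - by move=> ik; right; apply/eqP/vx_inj/(red_aF red ik iw).
  - by move=> /eqP ->; left.
  - by move=> /eqP ->; right.
rewrite card2; have [ji|jDi] := eqVneq j i.
  by rewrite a_weight_loop -?{2}ji //= invr1.
rewrite a_weight_edge // => ii; move/eqP: jDi; apply.
exact/vx_inj/(red_aF red iw ii).
Qed.

(** A b-loop gives a class of size 1; otherwise b-edges in a single direction at [i] give size 2 and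
    b-edges in both directions size 3. *)
Lemma card_b_rel i : (#|b_rel i|%:R)^-1 = b_weight G (vx i).
Proof.
have [_ _ bV] := red_wf red.
have [ii|nii] := pselect (bE G (vx i) (vx i)).
  rewrite b_weight_loop // (@eq_card _ _ (pred1 i)) ?card1 ?invr1 //.
  move=> k; rewrite -!topredE /=; apply/b_relP/eqP => [[->//|ik|ki]|->].
  - exact/vx_inj/(red_bF red ik ii).
  - exact/vx_inj/(red_bI red ki ii).
  - by constructor 1.
have [[w iw]|nout] := pselect (exists w, bE G (vx i) w); last first.
  have [w wi] : exists w, bE G w (vx i).
    by have [w [iw|wi]] := red_b red (Vvx i); [case: nout|]; exists w.
  have [j jE] : exists j, w = vx j by apply: vx_surj; case: (bV _ _ wi).
  rewrite jE in wi; rewrite b_weight_edge //; last by case.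
  rewrite (@eq_card _ _ (pred2 i j)) ?card2.
    by have [ji|//] := eqVneq j i; case: nii; rewrite -{1}ji.
  move=> k; rewrite -!topredE /=.
  apply/b_relP/orP => [[->|ik|ki]|[/eqP->|/eqP->]].
  - by left.
  - by case: nout; exists (vx k).
  - by right; apply/eqP/vx_inj/(red_bI red ki wi).
  - by constructor 1.
  - by constructor 3.
have [j jE] : exists j, w = vx j by apply: vx_surj; case: (bV _ _ iw).
rewrite jE in iw.
have [[x xi]|nin] := pselect (exists x, bE G x (vx i)); last first.
  rewrite b_weight_edge //; last by case.
  rewrite (@eq_card _ _ (pred2 i j)) ?card2.
    by have [ji|//] := eqVneq j i; case: nii; rewrite -{2}ji.
  move=> k; rewrite -!topredE /=.
  apply/b_relP/orP => [[->|ik|ki]|[/eqP->|/eqP->]].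
  - by left.
  - by right; apply/eqP/vx_inj/(red_bF red ik iw).
  - by case: nin; exists (vx k).
  - by constructor 1.
  - by constructor 2.
have [k kE] : exists k, x = vx k by apply: vx_surj; case: (bV _ _ xi).
rewrite kE in xi; rewrite (b_weight_triangle nii xi iw).
rewrite (@eq_card _ _ (mem [:: i; j; k])).
  rewrite (card_uniqP _) //= !inE negb_or.
  have neq (a b : 'I_n) : bE G (vx a) (vx b) ->
      bE G (vx i) (vx b) \/ bE G (vx a) (vx i) -> a != b.
    move=> ab h; apply/eqP => E; subst b; apply: nii.
    case: h => [ib|ai]; first by rewrite (red_bI red ib ab).
    by rewrite (red_bF red ai ab).
  rewrite neq //=; last by left.
  have jk : bE G (vx j) (vx k) by apply: (red_bT red xi iw).
  rewrite [i == k]eq_sym neq //=; last by right.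
  rewrite andbT; apply/eqP => E; subst k; apply: nii.
  by move: (jk); rewrite (red_bF red jk xi).
move=> l; transitivity (b_rel i l) => //.
transitivity (l \in [:: i; j; k]) => //; rewrite !inE.
apply/b_relP/or3P => [[->|il|li]|[/eqP->|/eqP->|/eqP->]].
- by constructor 1.
- by constructor 2; apply/eqP/vx_inj/(red_bF red il iw).
- by constructor 3; apply/eqP/vx_inj/(red_bI red li xi).
- by constructor 1.
- by constructor 2.
- by constructor 3.
Qed.

(** By connectivity, a vector constant on the a-components and on the b-components is constant, so
    the intersection is a line. *)
Lemma rank_avg_cap : \rank (avg_mx a_rel :&: avg_mx b_rel) = 1%N.
Proof.
pose c : 'rV[rat]_n := const_mx 1.
have [v0 /vx_surj[i0 _]] := red_neq0 red.
suff E : (avg_mx a_rel :&: avg_mx b_rel :=: c)%MS.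
  rewrite E rank_rV; case: eqP => // /rowP/(_ i0).
  by rewrite !mxE => /eqP; rewrite oner_eq0.
apply/eqmxP/andP; split; last first.
  rewrite sub_capmx; apply/andP; split.
    by apply/(sub_avg_mx a_rel_eqv) => i j _; rewrite !mxE.
  by apply/(sub_avg_mx b_rel_eqv) => i j _; rewrite !mxE.
apply/row_subP => k.
move: (row k _) (row_sub k (avg_mx a_rel :&: avg_mx b_rel)%MS) => u.
rewrite sub_capmx.
move=> /andP[/(sub_avg_mx a_rel_eqv) ua /(sub_avg_mx b_rel_eqv) ub].
suff -> : u = u 0 i0 *: c by apply: scalemx_sub.
apply/rowP => j; rewrite !mxE mulr1.
pose P x := forall i, x = vx i -> u 0 i = u 0 i0.
have [aV _ bV] := red_wf red.
have Pc x y : aE G x y \/ bE G x y \/ bE G y x -> P x -> P y.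
  move=> xy Px l yE.
  have [i xE] : exists i, x = vx i.
    by apply: vx_surj; case: xy => [/aV[]|[/bV[]|/bV[]]].
  rewrite -(Px i xE); subst x y; case: xy => [xy|xy].
    by apply/esym/ua/a_relP; right.
  by apply/esym/ub/b_relP; case: xy; [constructor 2|constructor 3].
apply: (red_conn red (P := P) _ (Vvx i0) (Vvx j)) => //.
- move=> x y [xy|xy]; split; apply: Pc.
  + by left. + by left; apply: aS. + by right; left. + by right; right.
- by move=> i /vx_inj <-.
Qed.

(** The pullback of [u] to a [K]-invariant function on the group, with the default 0 at cosets
    outside the Stallings graph. *)
Definition lift_row (u : 'rV[rat]_n) (g : PSL2Z) : rat :=
  \sum_i (if `[< rcoset_set K g = vert i >] then u 0 i else 0).

Lemma lift_rowE u g i : rcoset_set K g = vert i -> lift_row u g = u 0 i.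
Proof.
move=> gi; rewrite /lift_row (bigD1 i) //= asboolT // big1 ?addr0 // => j ji.
rewrite asboolF // => gj; move/eqP: ji; apply; apply: vert_inj.
by rewrite -gj -gi.
Qed.

Lemma lift_rowM u k g : K k -> lift_row u (k * g)%g = lift_row u g.
Proof. by move=> Kk; rewrite /lift_row rcoset_setM. Qed.

Local Notation pot u := (potential (lift_row u)).

(** The increments of [lift_row u] are [K]-invariant, so [E] is unchanged by both generators. In
    particular the potential restricts to a homomorphism on [K]. *)
Lemma potentialM u k g : K k -> pot u (k * g)%g = pot u k + pot u g.
Proof.
move=> Kk; pose E h := pot u (k * h)%g - pot u h.
suff : E g = E 1%g.
  by rewrite /E mulg1 potential1 subr0 => <-; rewrite subrK.
apply: psl_const => h; rewrite /E mulgA ?potential_a ?potential_b //.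
by rewrite -mulgA !(lift_rowM _ _ Kk); ring.
Qed.

(** Both sides vanish at 1 and have the same increments along the generators. *)
Lemma potential_sum u g : pot u g = \sum_i u 0 i * pot (delta_mx 0 i) g.
Proof.
pose E g := pot u g - \sum_i u 0 i * pot (delta_mx 0 i) g.
suff : E g = E 1%g.
  rewrite /E potential1 [X in _ = 0 - X]big1 => [|i _]; last first.
    by rewrite potential1 mulr0.
  by rewrite subrr => /eqP; rewrite subr_eq0 => /eqP.
have lin h : lift_row u h = \sum_i u 0 i * lift_row (delta_mx 0 i) h.
  rewrite /lift_row [RHS](eq_bigr (fun i => \sum_j
    (if `[< rcoset_set K h = vert j >] then u 0 i * (i == j)%:R else 0)))
    => [|i _]; last first.
    rewrite mulr_sumr; apply: eq_bigr => j _; rewrite mxE eqxx eq_sym /=.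
    by case: ifP; rewrite ?mulr0.
  rewrite exchange_big /=; apply: eq_bigr => j _; case: ifP => hj.
    rewrite (bigD1 j) //= eqxx mulr1 big1 ?addr0 // => i /negPf->.
    by rewrite mulr0.
  by rewrite big1.
apply: psl_const => h; rewrite /E.
  rewrite potential_a !lin.
  under [X in _ - X]eq_bigr do rewrite potential_a mulrDr mulrBr.
  by rewrite big_split sumrB /=; ring.
by rewrite potential_b; under [X in _ - X]eq_bigr do rewrite potential_b.
Qed.

(** The matrix of the linear map sending [u] to its potential on [K], recorded by the values at the
    free generators. *)
Definition hom_mx : 'M[rat]_(n, r) :=
  \matrix_(i, k) pot (delta_mx 0 i) (F (z k)).

Lemma mul_hom_mx u k : (u *m hom_mx) 0 k = pot u (F (z k)).
Proof. by rewrite mxE potential_sum; apply: eq_bigr => i _; rewrite mxE. Qed.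

Lemma FKx x : K (F x). Proof. by rewrite -FK; exists x. Qed.

Lemma vert_const (E : PSL2Z -> rat) :
  (forall g i j, rcoset_set K g = vert i ->
    rcoset_set K (g * psl_a)%g = vert j ->
    a_rel i j -> E (g * psl_a)%g = E g) ->
  (forall g i j, rcoset_set K g = vert i ->
    rcoset_set K (g * psl_b)%g = vert j ->
    b_rel i j -> E (g * psl_b)%g = E g) ->
  forall k, K k -> E k = E 1%g.
Proof.
have [aV _ bV] := wf_stallings K.
move=> Ea Eb; apply: stallings_const => // g gg.
- have [/vert_surj[i gi] /vert_surj[j gj]] := aV _ _ gg.
  apply: (Ea _ _ _ gi gj); apply/a_relP; right; apply/vert_aE.
  by rewrite -gi -gj.
- have [/vert_surj[i gi] /vert_surj[j gj]] := bV _ _ gg.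
  apply: (Eb _ _ _ gi gj); apply/b_relP; constructor 2; apply/vert_bE.
  by rewrite -gi -gj.
Qed.

(** Elements of [K] are reached along Stallings edges, and [u] has no increment along the a-edges
    among them. *)
Lemma a_const_hom0 (u : 'rV_n) : (u <= avg_mx a_rel)%MS -> u *m hom_mx = 0.
Proof.
move=> /(sub_avg_mx a_rel_eqv) ua; apply/rowP => k; rewrite mul_hom_mx mxE.
rewrite -(potential1 (lift_row u)); apply: vert_const; last exact: FKx.
- move=> g i j gi gj ij; rewrite potential_a.
  by rewrite (lift_rowE _ gi) (lift_rowE _ gj) (ua _ _ ij) subrr addr0.
- by move=> g i j _ _ _; rewrite potential_b.
Qed.

(** The potential minus [lift_row u] is unchanged along a-edges by construction and along b-edges by
    hypothesis, while [lift_row u] takes a single value on [K]. *)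
Lemma b_const_hom0 (u : 'rV_n) : (u <= avg_mx b_rel)%MS -> u *m hom_mx = 0.
Proof.
move=> /(sub_avg_mx b_rel_eqv) ub; apply/rowP => k; rewrite mul_hom_mx mxE.
pose E g := pot u g - lift_row u g.
have Fzk := FKx (z k); suff : E (F (z k)) = E 1%g.
  rewrite /E potential1 -[in lift_row u (F _)](mulg1 (F (z k))) lift_rowM //.
  by move/addIr.
apply: vert_const Fzk.
- by move=> g i j _ _ _; rewrite /E potential_a; ring.
- move=> g i j gi gj ij; rewrite /E potential_b.
  by rewrite (lift_rowE _ gi) (lift_rowE _ gj) (ub _ _ ij).
Qed.

Let vert_rep : exists g : 'I_n -> PSL2Z, forall i, vert i = rcoset_set K (g i).
Proof.
suff /choice[g gE] : forall i, exists g, vert i = rcoset_set K g by exists g.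
move=> i.
have [w iw] := red_a red (Vvx i).
have [j wE] : exists j, w = vx j.
  by apply: vx_surj; have [aV _ _] := red_wf red; case: (aV _ _ iw).
rewrite wE in iw; move/vert_aE/stallings_aE: iw => [g [-> _]].
by exists g.
Qed.

(** A potential vanishing on [K] descends to the cosets as a vector [p]. It is constant along
    b-edges and has the increments of [u] along a-edges, so [u = (u - p) + p] is the required
    decomposition. *)
Lemma hom0_sum (u : 'rV_n) :
  u *m hom_mx = 0 -> (u <= avg_mx a_rel + avg_mx b_rel)%MS.
Proof.
move=> u0.
have potK k : K k -> pot u k = 0.
  rewrite -FK => -[x _ <-].
  apply: (@free_product_hom0 r2 r3 r (fun x => pot u (F x))).
    by move=> a b /=; rewrite gmulfM potentialM //; apply: FKx.
  by move=> j; rewrite -mul_hom_mx u0 mxE.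
have potM k g : K k -> pot u (k * g)%g = pot u g.
  by move=> Kk; rewrite potentialM // potK // add0r.
have [g gE] := vert_rep.
have potE h i : rcoset_set K h = vert i -> pot u h = pot u (g i).
  by rewrite gE => /rcoset_set_eq[//|k Kk ->]; rewrite potM.
pose p : 'rV[rat]_n := \row_i pot u (g i).
rewrite -(subrK p u); apply: addmx_sub_adds.
- apply/(sub_avg_mx a_rel_eqv) => i j /a_relP[->//|/vert_aE/stallings_aE].
  case=> // h [iE jE]; rewrite !mxE -(potE _ _ (esym iE)) -(potE _ _ (esym jE)).
  rewrite potential_a (lift_rowE _ (esym iE)) (lift_rowE _ (esym jE)); ring.
- have bc i j : bE G (vx i) (vx j) -> p 0 i = p 0 j.
    move=> /vert_bE/stallings_bE[h [iE jE]]; rewrite !mxE.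
    by rewrite -(potE _ _ (esym iE)) -(potE _ _ (esym jE)) potential_b.
  by apply/(sub_avg_mx b_rel_eqv) => i j /b_relP[->//|/bc//|/bc].
Qed.

(** The homomorphism with values [t] is extended to a function on the whole group that is
    equivariant under [K] and invariant under [b]; its a-increments come from a [K]-invariant
    function [h], whose values at the vertices form the preimage of [t]. *)
Lemma hom_mx_onto (t : 'rV[rat]_r) : (t <= hom_mx)%MS.
Proof.
(* [xget] inverts [F] on its range, with the default 1 elsewhere. *)
have [phi phiF] : exists phi : PSL2Z -> rat,
    forall x, phi (F x) = fp_hom (fun k => t 0 k) x.
  exists (fun g => fp_hom (fun k => t 0 k) (xget 1%g [set y | F y = g])) => x.
  by congr fp_hom; apply: Finj; apply: (@xgetI _ _ [set y | F y = F x]).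
have phiM k l : K k -> K l -> phi (k * l)%g = phi k + phi l.
  rewrite -FK => -[x _ <-] [y _ <-]; rewrite -gmulfM !phiF; exact: fp_homM.
(* The representative [c g] depends only on the coset of [g], so that [d] below picks up exactly
   [phi k] under left multiplication by [k]. *)
pose c g := xget 1%g (rcoset_set K g).
have cM k g : K k -> c (k * g)%g = c g by move=> Kk; rewrite /c rcoset_setM.
have cK g : K (g * (c g)^-1)%g.
  have [k Kk <-] : rcoset_set K g (c g).
    exact: xgetI (rcoset_set_self Ksub g).
  have [K1 KV] := Ksub.
  by rewrite invgM mulVKg -(mul1g (k^-1)%g); apply: KV.
pose d g := phi (g * (c g)^-1)%g.
have dM k g : K k -> d (k * g)%g = phi k + d g.
  by move=> Kk; rewrite /d cM // -mulgA; apply: phiM.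
(* Averaging d over <b> makes it b-invariant; h is then its antisymmetric part
   under a, which has the same increments along the a-edges. *)
pose D g := (d g + d (g * psl_b)%g + d (g * psl_b * psl_b)%g) / 3.
have DM k g : K k -> D (k * g)%g = phi k + D g.
  by move=> Kk; rewrite /D -!mulgA !(dM _ _ Kk); field.
have Db g : D (g * psl_b)%g = D g.
  have bbb : (g * psl_b * psl_b * psl_b = g)%g.
    by rewrite -!mulgA (mulgA psl_b) psl_bbb mulg1.
  by rewrite /D bbb; congr (_ / _); ring.
pose h g := (D g - D (g * psl_a)%g) / 2.
have hM k g : K k -> h (k * g)%g = h g.
  by move=> Kk; rewrite /h -mulgA !(DM _ _ Kk); congr (_ / _); ring.
have ha g : h (g * psl_a)%g - h g = D (g * psl_a)%g - D g.
  by rewrite /h -[(g * psl_a * _)%g]mulgA psl_aa mulg1; field.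
have [g gE] := vert_rep.
pose u : 'rV[rat]_n := \row_i h (g i).
have uE i x : rcoset_set K x = vert i -> lift_row u x = h x.
  move=> xi; rewrite (lift_rowE _ xi) mxE; move: xi.
  by rewrite gE => /rcoset_set_eq[//|k Kk ->]; rewrite hM.
suff -> : t = u *m hom_mx by apply: submxMl.
apply/rowP => k; rewrite mul_hom_mx.
pose E x := pot u x - D x.
have Fzk := FKx (z k); suff : E (F (z k)) = E 1%g.
  rewrite /E potential1 -[in D (F _)](mulg1 (F (z k))) DM // phiF fp_hom_gen.
  by lra.
apply: vert_const Fzk.
- move=> x i j xi xj _; rewrite /E potential_a (uE _ _ xi) (uE _ _ xj) ha; ring.
- by move=> x i j _ _ _; rewrite /E potential_b Db.
Qed.

Lemma rank_hom_mx : \rank hom_mx = r.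
Proof.
apply/eqP; rewrite eqn_leq rank_leq_col /= -{1}(mxrank1 rat r) mxrankS //.
by apply/row_subP => i; apply: hom_mx_onto.
Qed.

Lemma ker_hom_mx : (kermx hom_mx :=: avg_mx a_rel + avg_mx b_rel)%MS.
Proof.
apply/eqmxP/andP; split; first by apply/row_subP => i; apply: hom0_sum;
  apply/sub_kermxP; apply: row_sub.
rewrite addsmx_sub; apply/andP; split; apply/row_subP => i; apply/sub_kermxP.
  by apply: a_const_hom0; apply: row_sub.
by apply: b_const_hom0; apply: row_sub.
Qed.

(** By rank-nullity, [n - r] is the dimension of the kernel, namely the number of a-components plus
    that of b-components minus 1 for the constants. *)
Lemma free_rank_chi : r%:R = 1 - chi G.
Proof.
have rn : (r <= n)%N by rewrite -{1}rank_hom_mx rank_leq_row.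
have := mxrank_sum_cap (avg_mx a_rel) (avg_mx b_rel).
rewrite rank_avg_cap -ker_hom_mx mxrank_ker rank_hom_mx.
move=> /(congr1 (fun m => m%:R : rat)); rewrite !natrD natrB //.
rewrite (rank_avg_mx a_rel_eqv) (rank_avg_mx b_rel_eqv).
have -> : chi G = \sum_i (#|a_rel i|%:R)^-1 + \sum_i (#|b_rel i|%:R)^-1 - n%:R.
  rewrite /chi sV -fsbig_seq // big_tnth /weight sumrB big_split /=.
  rewrite sumr_const card_ord; congr (_ + _ - _).
    by apply: eq_bigr => i _; rewrite card_a_rel.
  by apply: eq_bigr => i _; rewrite card_b_rel.
by lra.
Qed.

End HomDimension.

(** * Free rank of a subgroup and of its silhouette *)

Lemma iso_type_chi (U : choiceType) (G : graph U) (K : set PSL2Z)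
    (r2 r3 r : nat) :
  reduced G -> is_subgroup K -> graph_iso G (stallings K) ->
  iso_type K r2 r3 r -> r%:R = 1 - chi G.
Proof.
move=> red Ksub [f fiso] [F [Finj FK]].
have [s0 s0V] := (finite_seqP _).1 (red_fin red).
apply: (@free_rank_chi U G (undup s0) K f r2 r3 r F) => //.
  exact: undup_uniq.
by rewrite s0V; apply/seteqP; split=> x /=; rewrite mem_undup.
Qed.

Local Close Scope ring_scope.
Local Close Scope classical_set_scope.

Theorem proposition3p3 (H : set PSL2Z) (l2 l3 r : nat)
    (S : graph (set PSL2Z)) :
  is_subgroup H -> finitely_generated H -> psl_cyclically_reduced H ->
  iso_type H l2 l3 r ->
  silhouette (stallings H) S ->
  (forall l2' l3' r' : nat, graph_iso_type S l2' l3' r' -> r = r') /\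
  (graph_iso S Delta1 <-> r = 0) /\
  (graph_iso S Delta2 <-> r = 1).
Proof.
move=> Hsub _ /cyclically_reduced_reduced redH typeH silh.
have [redS chiS] := silhouette_reduced redH silh.
have rE : (r%:R = 1 - chi S)%R.
  rewrite chiS; apply: iso_type_chi typeH => //.
  by exists id; split=> //; split=> // x Vx; exists x.
have r_nat (m : nat) : (1 - chi S = m%:R)%R -> r = m.
  by rewrite -rE => /eqP; rewrite eqr_nat => /eqP.
have D1 : graph_iso S Delta1 -> chi S = 1%R.
  move=> /(chi_iso (red_wf redS) (wf_Delta1_at tt)) ->.
  exact: chi_Delta1_at.
have D2 : graph_iso S Delta2 -> chi S = 0%R.
  by move=> /(chi_iso (red_wf redS) wf_Delta2) ->; exact: chi_Delta2.
have cases := terminal_cases redS silh.2.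
split; [|split].
(* The Stallings graph of [K] is isomorphic to [S], so [r'] is also [1 - chi S]. *)
- move=> l2' l3' r' [v [K [_ Ksub _ [f [fiso _]] typeK]]].
  apply: r_nat; apply/esym; apply: iso_type_chi typeK => //; by exists f.
- split=> [/D1 E|r0]; first by apply: (r_nat 0%N); rewrite E subrr.
  (* Here [chi S] is 1, which excludes [Delta2], where it is 0, and negative values; the case
     [r = 1] below is symmetric, with [chi S] equal to 0. *)
  by case: cases => // [/D2|] E; move: rE; rewrite r0; lra.
- split=> [/D2 E|r1]; first by apply: (r_nat 1%N); rewrite E subr0.
  by case: cases => // [/D1|] E; move: rE; rewrite r1; lra.
Qed.
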